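(* Let $G\subset[0,1]^n$ be a compact set of positive Lebesgue measure with empty interior and let $b=\{b_m\}_{m\in\mathbb{N}}\subset(0,1)$ satisfy $\lim_{m\to\infty}b_m=0$. Let $G_m:=(2m,0,\dots,0)+G$ for $m\in\mathbb{N}$, and define the weight $w_{G,b}$ on $\mathbb{R}^n$ as follows: for $y=(y_1,\dots,y_n)$ with $y_1\ge0$, $w_{G,b}(y)=b_m$ if $y\in G_m$ for some $m\in\mathbb{N}$ and $w_{G,b}(y)=1$ if $y\notin\bigcup_{m}G_m$; for $y_1<0$, $w_{G,b}(y):=w_{G,b}(-y)$. Then there exists $a\in S(\mathbb{R}^n)$ such that $a\in\mathcal{M}_{L^\infty(\mathbb{R}^n,w_{G,b})}\setminus\mathcal{M}^0_{L^\infty(\mathbb{R}^n,w_{G,b})}$.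
   Context: $L^\infty(\mathbb{R}^n,w)$ is the space of measurable $f$ with $\|f\|_{L^\infty(\mathbb{R}^n,w)}:=\|fw\|_{L^\infty(\mathbb{R}^n)}<\infty$. Fourier transform: $(Fu)(\xi)=\int u(x)e^{-ix\xi}dx$. For a normed function space $X$: $\mathcal{M}_{X}$ is the set of tempered distributions $a\in S'(\mathbb{R}^n)$ with $\sup\{\|F^{-1}aFu\|_{X}/\|u\|_{X}: u\in (S(\mathbb{R}^n)\cap X)\setminus\{0\}\}<\infty$ (Fourier transforms on $S$, $S'$); $\mathcal{M}^0_{X}$ is the set of $a\in L^\infty(\mathbb{R}^n)$ with $\sup\{\|F^{-1}aFu\|_{X}/\|u\|_{X}: u\in (L^2(\mathbb{R}^n)\cap X)\setminus\{0\}\}<\infty$, with $F^{\pm1}$ the Fourier transforms on $L^2(\mathbb{R}^n)$. *)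

(* Defs.v *)
From HB Require Import structures.
From mathcomp Require Import all_boot all_order all_algebra.
From mathcomp Require Import all_classical all_reals all_analysis.
From mathcomp Require Import ess_sup_inf.
From mathcomp Require Import complex.

Set Implicit Arguments.
Unset Strict Implicit.
Unset Printing Implicit Defensive.

Import Order.TTheory GRing.Theory Num.Theory.
Import numFieldNormedType.Exports.

Local Open Scope classical_set_scope.
Local Open Scope ring_scope.

Definition box {R : realType} {n : nat} (a b : 'rV[R]_n) : set 'rV[R]_n :=
  [set x | forall i, a 0 i <= x 0 i < b 0 i].

Definition boxvol {R : realType} {n : nat} (a b : 'rV[R]_n) : R :=
  \prod_(i < n) (b 0 i - a 0 i).

(* elementary volume: vol of a box, +oo on non-boxes, 0 on the empty set *)
Definition box_content {R : realType} {n : nat} (A : set 'rV[R]_n) : \bar R :=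
  if pselect (A = set0) then 0%E else
  ereal_inf [set (boxvol ab.1 ab.2)%:E | ab in
     [set ab : 'rV[R]_n * 'rV[R]_n |
        (forall i, ab.1 0 i <= ab.2 0 i) /\ A = box ab.1 ab.2]].

Lemma box_content0 {R : realType} {n : nat} : box_content (set0 : set 'rV[R]_n) = 0%E.
Proof. by rewrite /box_content; destruct (pselect (@set0 'rV[R]_n = set0)). Qed.

Lemma box_content_ge0 {R : realType} {n : nat} (A : set 'rV[R]_n) :
  (0 <= box_content A)%E.
Proof.
rewrite /box_content; destruct (pselect (A = set0)) as [h0|nA]; first by [].
apply: le_ereal_inf_tmp => y [ab [hab _] <-].
rewrite lee_fin /boxvol; apply: prodr_ge0 => i _; rewrite subr_ge0; exact: (hab i).
Qed.

(* auxiliary copy of R^n on which every set is "measurable", only used to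
   feed the covering construction mu_ext (covers by arbitrary sets, each
   charged box_content, i.e. +oo unless it is a box) *)
Definition Rn_all (R : realType) (n : nat) := 'rV[R]_n.
HB.instance Definition _ (R : realType) n := Choice.on (Rn_all R n).
HB.instance Definition _ (R : realType) n :=
  isPointed.Build (Rn_all R n) (0 : 'rV[R]_n).
HB.instance Definition _ (R : realType) n :=
  @isMeasurable.Build default_measure_display (Rn_all R n) setT
    I (fun _ _ => I) (fun _ _ => I).

Definition leb_outer (R : realType) (n : nat) : set (Rn_all R n) -> \bar R :=
  mu_ext (box_content : set (Rn_all R n) -> \bar R).
Arguments leb_outer : clear implicits.

Lemma leb_outer0 (R : realType) n : leb_outer R n set0 = 0%E.
Proof. exact: (@mu_ext0 _ (Rn_all R n) R box_content box_content0 box_content_ge0). Qed.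
Lemma leb_outer_ge0 (R : realType) n (A : set (Rn_all R n)) : (0 <= leb_outer R n A)%E.
Proof. exact: (@mu_ext_ge0 _ (Rn_all R n) R box_content box_content_ge0). Qed.
Lemma le_leb_outer (R : realType) n :
  {homo leb_outer R n : A B / A `<=` B >-> (A <= B)%E}.
Proof. exact: (@le_mu_ext _ (Rn_all R n) R box_content). Qed.
Lemma leb_outer_sigma_subadditive (R : realType) n :
  sigma_subadditive (leb_outer R n).
Proof. exact: (@mu_ext_sigma_subadditive _ (Rn_all R n) R box_content box_content_ge0). Qed.

HB.instance Definition _ (R : realType) n :=
  isOuterMeasure.Build R (Rn_all R n) (leb_outer R n)
    (leb_outer0 R n) (@leb_outer_ge0 R n) (@le_leb_outer R n)
    (@leb_outer_sigma_subadditive R n).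

Definition leb_outer_om (R : realType) (n : nat) :
  {outer_measure set (Rn_all R n) -> \bar R} := leb_outer R n.
Definition Leb (R : realType) (n : nat) := caratheodory_type (leb_outer_om R n).

Definition lebesgue (R : realType) (n : nat) : {measure set (Leb R n) -> \bar R} :=
  (leb_outer_om R n : set (caratheodory_type (leb_outer_om R n)) -> \bar R).

Local Open Scope complex_scope.

Definition cre {R : realType} (z : R[i]) : R := let: a +i* _ := z in a.
Definition cim {R : realType} (z : R[i]) : R := let: _ +i* b := z in b.

Definition cabs {R : realType} (z : R[i]) : R :=
  Num.sqrt (cre z ^+ 2 + cim z ^+ 2).

Definition expi {R : realType} (t : R) : R[i] := cos t +i* sin t.

Definition dotv {R : realType} {n : nat} (x y : 'rV[R]_n) : R :=
  \sum_(i < n) x 0 i * y 0 i.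

Definition cint {R : realType} {n : nat} (f : 'rV[R]_n -> R[i]) : R[i] :=
  (\int[lebesgue R n]_(x in [set: Leb R n]) cre (f x))%R
  +i* (\int[lebesgue R n]_(x in [set: Leb R n]) cim (f x))%R.

Definition cmeasurable {R : realType} {n : nat} (f : 'rV[R]_n -> R[i]) : Prop :=
  measurable_fun [set: Leb R n] (fun x : Leb R n => cre (f x)) /\
  measurable_fun [set: Leb R n] (fun x : Leb R n => cim (f x)).

Definition L2 {R : realType} {n : nat} (f : 'rV[R]_n -> R[i]) : Prop :=
  cmeasurable f /\
  (\int[lebesgue R n]_(x in [set: Leb R n]) ((cabs (f x)) ^+ 2)%:E < +oo)%E.

Definition Linfty {R : realType} {n : nat} (f : 'rV[R]_n -> R[i]) : Prop :=
  cmeasurable f /\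
  (ess_sup (lebesgue R n) (fun x : Leb R n => (cabs (f x))%:E) < +oo)%E.

Definition fourier {R : realType} {n : nat} (u : 'rV[R]_n -> R[i]) :
    'rV[R]_n -> R[i] :=
  fun xi => cint (fun x => u x * expi (- dotv x xi)).

Definition ifourier {R : realType} {n : nat} (h : 'rV[R]_n -> R[i]) :
    'rV[R]_n -> R[i] :=
  fun x => ((2 * pi) ^- n)%:C * cint (fun xi => h xi * expi (dotv x xi)).

Fixpoint dpart {R : realType} {n : nat} (l : seq 'I_n) (g : 'rV[R]_n -> R) :
    'rV[R]_n -> R :=
  match l with
  | [::] => g
  | i :: l' => fun x => 'D_(delta_mx 0 i) (dpart l' g) x
  end.

Definition rschwartz {R : realType} {n : nat} (g : 'rV[R]_n -> R) : Prop :=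
  forall l : seq 'I_n,
    continuous (dpart l g) /\
    (forall (i : 'I_n) (x : 'rV[R]_n), derivable (dpart l g) x (delta_mx 0 i)) /\
    (forall alpha : 'I_n -> nat, exists C : R, forall x : 'rV[R]_n,
       `| (\prod_(i < n) x 0 i ^+ alpha i) * dpart l g x | <= C).

Definition schwartz {R : realType} {n : nat} (f : 'rV[R]_n -> R[i]) : Prop :=
  rschwartz (fun x => cre (f x)) /\ rschwartz (fun x => cim (f x)).

Definition wnorm {R : realType} {n : nat} (w : 'rV[R]_n -> R)
    (f : 'rV[R]_n -> R[i]) : \bar R :=
  ess_sup (lebesgue R n) (fun x : Leb R n => (cabs (f x) * w x)%:E).

Definition in_Linfty_w {R : realType} {n : nat} (w : 'rV[R]_n -> R)
    (f : 'rV[R]_n -> R[i]) : Prop :=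
  cmeasurable f /\ (wnorm w f < +oo)%E.

(* a in M_X, for a symbol a given by a function (a regular tempered
   distribution, e.g. a in S(R^n)); for u in S(R^n) and such a,
   F^{-1} a F u is computed by Lebesgue integrals.
   "sup ||F^{-1} a F u||_X / ||u||_X < oo over u in (S cap X) \ {0}"
   is written as a uniform bound with a constant C. *)
Definition mult_op {R : realType} {n : nat} (a u : 'rV[R]_n -> R[i]) :
    'rV[R]_n -> R[i] :=
  ifourier (fun xi => a xi * fourier u xi).

Definition multiplier_S {R : realType} {n : nat} (w : 'rV[R]_n -> R)
    (a : 'rV[R]_n -> R[i]) : Prop :=
  exists C : R, forall u : 'rV[R]_n -> R[i],
    schwartz u -> in_Linfty_w w u ->
    (wnorm w (mult_op a u) <= C%:E * wnorm w u)%E.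

(* Fourier transform on L^2(R^n): g = F u (u, g in L^2) iff
   <g, phi> = <u, F phi> for every phi in S(R^n). *)
Definition fourierL2 {R : realType} {n : nat} (u g : 'rV[R]_n -> R[i]) : Prop :=
  L2 u /\ L2 g /\
  forall phi : 'rV[R]_n -> R[i], schwartz phi ->
    cint (fun xi => g xi * phi xi) = cint (fun x => u x * fourier phi x).

(* a in M^0_X: a in L^infty and F^{-1} a F (with the L^2 Fourier
   transforms) is bounded on L^2 cap X w.r.t. the X-norm.
   v = F^{-1}(a F u) is expressed as  F v = a (F u). *)
Definition multiplier0 {R : realType} {n : nat} (w : 'rV[R]_n -> R)
    (a : 'rV[R]_n -> R[i]) : Prop :=
  Linfty a /\
  exists C : R, forall u g v : 'rV[R]_n -> R[i],
    L2 u -> in_Linfty_w w u ->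
    fourierL2 u g -> fourierL2 v (fun xi => a xi * g xi) ->
    (wnorm w v <= C%:E * wnorm w u)%E.

Definition shift_vec {R : realType} {n : nat} (m : nat) : 'rV[R]_n :=
  \row_(i < n) (if val i == 0%N then (2 * m)%:R else 0).

Definition Gm {R : realType} {n : nat} (G : set 'rV[R]_n) (m : nat) :
    set 'rV[R]_n :=
  [set y | G (y - shift_vec m)].

(* weight on the half space y_1 >= 0 (m ranges over N = {1, 2, ...}) *)
Definition wplus {R : realType} {n : nat} (G : set 'rV[R]_n) (b : nat -> R)
    (y : 'rV[R]_n) : R :=
  if pselect (exists m : nat, (0 < m)%N /\ Gm G m y)
  then b (xget 0%N [set m : nat | (0 < m)%N /\ Gm G m y])
  else 1.

Definition wGb {R : realType} {n : nat} (hn : (0 < n)%N)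
    (G : set 'rV[R]_n) (b : nat -> R) (y : 'rV[R]_n) : R :=
  if 0 <= y 0 (Ordinal hn) then wplus G b y else wplus G b (- y).

(* Main.v *)
Require Import Defs.
From HB Require Import structures.
From mathcomp Require Import all_boot all_order all_algebra.
From mathcomp Require Import all_classical all_reals all_analysis.
From mathcomp Require Import ess_sup_inf measurable_realfun.
From mathcomp Require Import complex.
From mathcomp Require Import ring lra zify.

(** The symbol is a Gaussian, whose inverse Fourier transform is a positive
Gaussian [K].  Since [G] is closed with empty interior and the translates [G_m]
are well separated, [w = 1] on a dense open set; hence a continuous [u] has the
same norm in the weighted space as in the sup norm, and convolution by the
integrable kernel [K] is bounded on Schwartz functions.  On the other hand the
indicator of [G_m] is a legitimate [L^2] input of weighted norm at most [b_m],
whereas its convolution with [K] is bounded below, uniformly in [m], on a cube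
next to [G_m] where [w = 1]; since [b_m] tends to 0 this rules out a bound on
[L^2].

No exact value of an integral is needed: only the behaviour of Lebesgue measure
under [x |-> l x + v] is used.  The Fourier transform of the Gaussian comes from
the differential equation [h' t = - t |xi|^2 h t] satisfied by
[h t = \int cos (t <x, xi> + th) exp (- |x|^2 / 2) dx], and the [L^2] bound on
the Fourier transform of an indicator from Gaussian regularisation. *)

Import Order.TTheory GRing.Theory Num.Theory.
Import numFieldNormedType.Exports.

Local Open Scope classical_set_scope.
Local Open Scope ring_scope.

Set Implicit Arguments.
Unset Strict Implicit.

(** * Boxes, measurability and affine maps *)

Section measure_on_Rn.
Context {R : realType} {n : nat}.
Implicit Types (a b x v : 'rV[R]_n) (A B : set 'rV[R]_n).

(** The two classes part because the weight makes functions living on [G_m] cheap, and only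
    discontinuous functions can live there: a continuous one takes nearly the same values at nearby
    points where [w = 1]. Positivity of the kernel then excludes cancellation when an indicator is
    smoothed.

    Neither Fourier inversion nor Plancherel is used. [multiplier0] refers to any [v] with
    [F v = a F u], so [v] is written down as a normalised convolution and its transform is computed
    forwards, by Fubini. Membership in [L2] asks only for finiteness, so any constant in Bessel's
    inequality will do. Hence [gauss_mass] can stay an unevaluated positive number, and the factor
    [(2 * pi) ^- n] of [ifourier] enters only a bound.

    The measure of the unit cube stays unknown as well. Coverings give upper bounds at once; a lower
    bound would need a compactness argument, and positivity is obtained instead from that of the
    measure of [G]. *)

Lemma box_content_box a b : (forall i, a 0 i <= b 0 i) ->
  (box_content (box a b) <= (boxvol a b)%:E)%E.
Proof.
move=> ab; rewrite /box_content; case: pselect => [h|h] /=.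
  by rewrite lee_fin; apply: prodr_ge0 => i _; rewrite subr_ge0.
by apply: ereal_inf_lbound; exists (a, b).
Qed.

Definition halfspace (i : 'I_n) (c : R) : set 'rV[R]_n := [set x | x 0 i < c].

(** A hyperplane orthogonal to an axis cuts a box into two boxes, and [boxvol] is additive in the
    side that is cut. *)
Lemma box_content_halfspace B (i : 'I_n) (c : R) :
  (box_content (B `&` halfspace i c) +
   box_content (B `&` ~` halfspace i c) <= box_content B)%E.
Proof.
rewrite [X in (_ <= X)%E]/box_content; case: pselect => [h|h] /=.
  by rewrite h !set0I !box_content0 adde0.
apply: le_ereal_inf_tmp => _ [[a b] /= [ab ->] <-].
(* Clamping [c] between [a 0 i] and [b 0 i] keeps the corners of both pieces ordered even when the
   hyperplane misses the box; one piece is then empty, with volume 0. *)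
pose c' := Order.max (a 0 i) (Order.min (b 0 i) c).
have ac' : a 0 i <= c' by rewrite /c' le_max lexx.
have c'b : c' <= b 0 i by rewrite /c' ge_max ab ge_min lexx.
pose b' : 'rV[R]_n := \row_j (if j == i then c' else b 0 j).
pose a' : 'rV[R]_n := \row_j (if j == i then c' else a 0 j).
have -> : box a b `&` halfspace i c = box a b'.
  apply/seteqP; split=> x /=.
    move=> [xab xc] j; have /andP[-> xb] := xab j; rewrite /b' mxE /=.
    by case: eqP => [ji|_//]; rewrite /c' lt_max lt_min -ji xb ji xc orbT.
  move=> xab'; have := xab' i; rewrite mxE eqxx => /andP[ax].
  rewrite /c' lt_max ltNge ax /= lt_min => /andP[xb xc]; split => // j.
  have := xab' j; rewrite mxE; case: eqP => // -> _.
  by rewrite ax xb.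
have -> : box a b `&` ~` halfspace i c = box a' b.
  apply/seteqP; split=> x /=.
    move=> [xab xc] j; have /andP[ax ->] := xab j; rewrite /a' mxE /= andbT.
    case: eqP => [ji|_//]; rewrite /c' ge_max -ji ax /= ge_min ji.
    by move/negP: xc; rewrite -leNgt => ->; rewrite orbT.
  move=> xab'; have := xab' i; rewrite mxE eqxx /c' ge_max => /andP[/andP[ax]].
  rewrite ge_min => bcx xb; split; last first.
    by apply/negP; rewrite -leNgt; move: bcx; rewrite leNgt xb.
  move=> j; have := xab' j; rewrite mxE; case: eqP => // -> _.
  by rewrite ax xb.
apply: (le_trans (leeD (box_content_box _) (box_content_box _))).
- by move=> j; rewrite mxE; case: eqP => [->|_].
- by move=> j; rewrite mxE; case: eqP => [->|_].
rewrite -EFinD lee_fin /boxvol (bigD1 i)//= [X in _ + X](bigD1 i)//=.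
rewrite [X in _ <= X](bigD1 i)//= !mxE eqxx.
set p := \prod_(_ < _ | _) _; set q := \prod_(_ < _ | _) _.
have -> : p = \prod_(j < n | j != i) (b 0 j - a 0 j).
  by apply: eq_bigr => j ji; rewrite mxE (negbTE ji).
have -> : q = \prod_(j < n | j != i) (b 0 j - a 0 j).
  by apply: eq_bigr => j ji; rewrite mxE (negbTE ji).
by rewrite -mulrDl addrC addrA subrK.
Qed.

Lemma leb_outer_le_cover A (F : nat -> set 'rV[R]_n) : A `<=` \bigcup_k F k ->
  (leb_outer R n A <= \sum_(k <oo) box_content (F k))%E.
Proof. by move=> AF; apply: ereal_inf_lbound; exists F. Qed.

(** Cutting every member of a cover of a test set [X] yields covers of the two pieces of [X] at no
    extra cost, which is the nontrivial half of the Carathéodory identity. *)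
Lemma measurable_halfspace (i : 'I_n) (c : R) :
  measurable (halfspace i c : set (Leb R n)).
Proof.
apply: (@le_caratheodory_measurable R _ (leb_outer_om R n)) => X.
apply: le_ereal_inf_tmp => _ [F [_ XF] <-].
set H := halfspace i c.
apply: (@le_trans _ _ (\sum_(k <oo) box_content (F k `&` H) +
                       \sum_(k <oo) box_content (F k `&` ~` H))%E).
  by apply: leeD; apply: leb_outer_le_cover; rewrite -setI_bigcupl; apply: setSI.
rewrite -nneseriesD//; last 2 first.
- by move=> k _ _; exact: box_content_ge0.
- by move=> k _ _; exact: box_content_ge0.
apply: lee_nneseries => [k _ _|k _].
  by apply: adde_ge0; exact: box_content_ge0.
exact: box_content_halfspace.
Qed.

Lemma measurable_coord (i : 'I_n) :
  measurable_fun [set: Leb R n] (fun x : Leb R n => (x : 'rV[R]_n) 0 i).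
Proof.
move=> mT; apply: (measurability _ (RGenCInfty.measurableE R)) => // => _ [_ [r ->] <-].
rewrite setTI (_ : _ @^-1` _ = ~` halfspace i r).
  exact/measurableC/measurable_halfspace.
apply/seteqP; split => x /=; rewrite in_itv/= andbT leNgt; first by move/negP.
by move=> /negP.
Qed.

Definition affine (l : R) v : 'rV[R]_n -> 'rV[R]_n := fun x => l *: x + v.

Lemma box_content_affine B (l : R) v : 0 < l ->
  (box_content (affine l v @^-1` B) <= (l ^- n)%:E * box_content B)%E.
Proof.
move=> l0; have ln : 0 < l ^- n by rewrite invr_gt0 exprn_gt0.
rewrite [X in (_ <= _ * X)%E]/box_content; case: pselect => [h|h] /=.
  by rewrite h preimage_set0 box_content0 mule0.
rewrite -lee_pdivrMl// ?exprn_gt0//.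
apply: le_ereal_inf_tmp => _ [[a b] /= [ab ->] <-].
rewrite lee_pdivrMl// -EFinM.
pose a' := l^-1 *: (a - v); pose b' := l^-1 *: (b - v).
have -> : affine l v @^-1` box a b = box a' b'.
  apply/seteqP; split=> x /= xab i; have := xab i; rewrite /affine !mxE.
    by rewrite ler_pdivrMl// ltr_pdivlMl// lerBlDr ltrBrDr.
  by rewrite ler_pdivrMl// ltr_pdivlMl// lerBlDr ltrBrDr.
apply: (le_trans (box_content_box _)).
  by move=> i; rewrite !mxE ler_pM2l ?invr_gt0// lerD2r.
rewrite lee_fin /boxvol -exprVn -[X in _ ^+ X]card_ord -prodr_const -big_split/=.
by apply: ler_prod => i _; rewrite !mxE -mulrBr opprB addrA subrK lexx andbT
  mulr_ge0 ?invr_ge0 ?(ltW l0)// subr_ge0.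
Qed.

Lemma leb_outer_affine_le A (l : R) v : 0 < l ->
  (leb_outer R n (affine l v @^-1` A) <= (l ^- n)%:E * leb_outer R n A)%E.
Proof.
move=> l0; have ln : 0 < l ^- n by rewrite invr_gt0 exprn_gt0.
rewrite -lee_pdivrMl//; apply: le_ereal_inf_tmp => _ [F [_ AF] <-].
rewrite lee_pdivrMl//.
apply: (@le_trans _ _ (\sum_(k <oo) box_content (affine l v @^-1` F k))%E).
  apply: leb_outer_le_cover; rewrite -preimage_bigcup.
  exact: preimage_subset.
rewrite -nneseriesZl; last by move=> *; exact: box_content_ge0.
apply: lee_nneseries => [k _ _|k _]; first exact: box_content_ge0.
exact: box_content_affine.
Qed.

(** The missing inequality is the previous one applied to the inverse map, which is affine with
    ratio [l^-1]. *)
Lemma leb_outer_affine A (l : R) v : 0 < l ->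
  leb_outer R n (affine l v @^-1` A) = ((l ^- n)%:E * leb_outer R n A)%E.
Proof.
move=> l0; have ln : 0 < l ^- n by rewrite invr_gt0 exprn_gt0.
apply/eqP; rewrite eq_le leb_outer_affine_le//=.
rewrite -lee_pdivlMl//.
have := @leb_outer_affine_le (affine l v @^-1` A) l^-1 (- (l^-1 *: v)).
rewrite invr_gt0 exprVn => /(_ l0); congr (leb_outer R n _ <= _)%E.
apply/seteqP; split=> x /=; rewrite /affine scalerDr scalerN !scalerA;
  by rewrite mulfV ?gt_eqF// !scale1r subrK.
Qed.

Lemma measurable_affine (l : R) v : 0 < l ->
  measurable_fun [set: Leb R n] (affine l v : Leb R n -> Leb R n).
Proof.
move=> l0 _ A mA; rewrite setTI.
have {}mA : caratheodory_measurable (leb_outer R n) A := mA.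
suff : caratheodory_measurable (leb_outer R n) (affine l v @^-1` A) by [].
move=> X.
(* Every test set is itself a preimage under the affine map, so the Carathéodory identity for [A]
   scales term by term. *)
have lK : affine l v @^-1` (affine l^-1 (- (l^-1 *: v)) @^-1` X) = X.
  apply/seteqP; split=> x /=; rewrite /affine scalerDr addrK scalerA;
  by rewrite mulVf ?gt_eqF// scale1r.
rewrite -lK preimage_setC -!preimage_setI.
rewrite !(leb_outer_affine _ _ l0) -ge0_muleDr; last 2 first.
- exact: leb_outer_ge0.
- exact: leb_outer_ge0.
by congr (_ * _)%E; exact: mA.
Qed.

End measure_on_Rn.

(** * Integration over R^n *)

Section step_functions.
Context {d} {T : measurableType d} {R : realType} (mu : {measure set T -> \bar R}).

(** An integrability criterion that asks only for upper bounds on the measures of the [A j], so it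
    can be used on R^n without computing any integral. *)
Lemma integrable_le_steps (f : T -> R) (c : nat -> R) (A : nat -> set T) (C : R) :
  measurable_fun [set: T] f -> (forall j, measurable (A j)) ->
  (forall j, 0 <= c j) -> 0 <= C ->
  (\sum_(j <oo) (c j)%:E * mu (A j) < +oo)%E ->
  (forall x, exists j, A j x /\ `|f x| <= C * c j) ->
  mu.-integrable [set: T] (EFin \o f).
Proof.
move=> mf mA c0 C0 cA fA.
pose M (x : T) : \bar R := (\sum_(j <oo) (c j * \1_(A j) x)%:E)%E.
have M0 x j : (0 <= (c j * \1_(A j) x)%:E)%E by rewrite lee_fin mulr_ge0.
have mj j : measurable_fun [set: T] (fun x => (c j * \1_(A j) x)%:E).
  by apply/measurable_EFinP; exact: measurable_funM.
have mM : measurable_fun [set: T] M.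
  by apply: ge0_emeasurable_sum => // j x _; exact: M0.
have M_ge0 x : (0 <= M x)%E by exact: nneseries_ge0.
have intM : (\int[mu]_(x in [set: T]) M x < +oo)%E.
  rewrite integral_nneseries//.
  apply: le_lt_trans cA; apply: lee_nneseries => [j _ _|j _]; first exact: integral_ge0.
  under eq_integral do rewrite EFinM.
  rewrite ge0_integralZl ?integral_indic ?setIT ?lee_fin//.
  by apply/measurable_EFinP.
apply/integrableP; split; first exact/measurable_EFinP.
apply: (@le_lt_trans _ _ (C%:E * \int[mu]_(x in [set: T]) M x)%E);
  last by rewrite lte_mul_pinfty.
rewrite -ge0_integralZl//.
apply: ge0_le_integral => //.
- by apply: measurableT_comp => //; exact/measurable_EFinP.
- by apply: emeasurable_funM.
move=> x _ /=.
have [j [Aj fj]] := fA x.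
apply: (@le_trans _ _ (C%:E * (c j * \1_(A j) x)%:E)%E).
  by rewrite -EFinM lee_fin indicE mem_set// mulr1.
apply: lee_wpmul2l; first by rewrite lee_fin.
by rewrite /M (nneseriesD1 (n := j))//= leeDl// nneseries_ge0.
Qed.

End step_functions.

Section lebesgue_integral_on_Rn.
Context {R : realType} {n : nat}.
Implicit Types (f g : 'rV[R]_n -> R) (v x : 'rV[R]_n).

Local Notation mu := (lebesgue R n).

Definition Lmeas f := measurable_fun [set: Leb R n] (f : Leb R n -> R).
Definition Lintegrable f := mu.-integrable [set: Leb R n] (EFin \o f).
Definition Lint f := (\int[mu]_(x in [set: Leb R n]) f x)%R.

Lemma Lintegrable_meas f : Lintegrable f -> Lmeas f.
Proof. by move=> /integrableP[/measurable_EFinP]. Qed.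

Lemma measurable_box (a b : 'rV[R]_n) : measurable (box a b : set (Leb R n)).
Proof.
rewrite (_ : box a b = \bigcap_(i : 'I_n) (~` halfspace i (a 0 i) `&` halfspace i (b 0 i))).
  apply: fin_bigcap_measurable => [|i _]; first exact: finite_finset.
  by apply: measurableI; [apply: measurableC|]; exact: measurable_halfspace.
apply/seteqP; split => x /= xab i.
  by move=> _; have /andP[ax xb] := xab i; split => //=; apply/negP; rewrite -leNgt.
have [] := xab i I => /=; rewrite /halfspace /= => /negP; rewrite -leNgt.
by move=> -> ->.
Qed.

(** An open set is the union of the boxes with rational corners that it contains, and there are
    countably many of these. *)
Lemma measurable_open (O : set 'rV[R]_n) : open O -> measurable (O : set (Leb R n)).
Proof.
move=> oO.
pose rbox (p : 'rV[rat]_n * 'rV[rat]_n) : set 'rV[R]_n :=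
  box (map_mx ratr p.1) (map_mx ratr p.2).
rewrite (_ : O = \bigcup_p (if pselect (rbox p `<=` O) then rbox p else set0)).
  apply: countable_bigcupT_measurable => [|p]; first exact: countableP.
  by case: pselect => h /=; [exact: measurable_box|exact: measurable0].
apply/seteqP; split => [x Ox|x [p _]]; last first.
  by case: pselect => h //= /h.
have /nbhs_ballP[e /= e0 xeO] : nbhs x O by exact: open_nbhs_nbhs.
have P i : exists q : rat, ratr q \in `]x 0 i - e, x 0 i[.
  by apply: rat_in_itvoo; rewrite ltrBlDr ltrDl.
have Q i : exists q : rat, ratr q \in `]x 0 i, x 0 i + e[.
  by apply: rat_in_itvoo; rewrite ltrDl.
pose p : 'rV[rat]_n := \row_i sval (cid (P i)).
pose q : 'rV[rat]_n := \row_i sval (cid (Q i)).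
exists (p, q) => //; case: pselect => [_|] /=.
  move=> i; rewrite !mxE; case: cid => a /=; case: cid => b /=.
  by rewrite !in_itv/= => /andP[xb _] /andP[_ /ltW ->].
case => y ypq; apply: xeO; split => // i j; rewrite ord1 /ball/=.
have := ypq j; rewrite !mxE; case: cid => a /=; case: cid => b /=.
rewrite !in_itv/= => /andP[xb be] /andP[ea ax] /andP[ay yb].
by rewrite ltr_norml; apply/andP; split; lra.
Qed.

Lemma continuous_Lmeas f : continuous f -> Lmeas f.
Proof.
move=> cf mT; apply: (measurability _ (RGenOpens.measurableE R)) => //.
move=> _ [_ [a [b ->]] <-]; rewrite setTI; apply: measurable_open.
by move/continuousP : cf; apply; exact: interval_open.
Qed.

Definition cube v (l : R) : set 'rV[R]_n := box v (\row_i (v 0 i + l)).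

Lemma lebesgue_cube_le v (l : R) : 0 <= l -> (mu (cube v l) <= (l ^+ n)%:E)%E.
Proof.
move=> l0; apply: (@le_trans _ _ (box_content (cube v l))).
  apply: (@le_trans _ _ (\sum_(k <oo)
      box_content (if k is 0%N then cube v l else set0))%E).
    by apply: leb_outer_le_cover => x vx; exists 0%N.
  rewrite nneseries_recl//; last by move=> k _; exact: box_content_ge0.
  by rewrite eseries0 ?adde0// => -[//|k] _ _; exact: box_content0.
apply: (le_trans (box_content_box _)) => [i|]; first by rewrite mxE lerDl.
rewrite lee_fin /boxvol -[X in _ ^+ X]card_ord -prodr_const le_eqVlt.
by apply/orP; left; apply/eqP/eq_bigr => i _; rewrite mxE addrC addKr.
Qed.

Lemma lebesgue_affine (A : set 'rV[R]_n) (l : R) v : 0 < l ->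
  mu (affine l v @^-1` A) = ((l ^- n)%:E * mu A)%E.
Proof. exact: leb_outer_affine. Qed.

Lemma cube_affine v (l : R) : 0 < l ->
  cube v l = affine l^-1 (- (l^-1 *: v)) @^-1` (cube 0 1).
Proof.
move=> l0; apply/seteqP; split=> x /= xv i; have := xv i; rewrite /affine !mxE add0r.
  by rewrite subr_ge0 ler_pM2l ?invr_gt0// -mulrBr ltr_pdivrMl// mulr1 ltrBlDl.
by rewrite subr_ge0 ler_pM2l ?invr_gt0// -mulrBr ltr_pdivrMl// mulr1 ltrBlDl.
Qed.

(** The unit cube remains as an unknown factor; only whether it is positive matters later. *)
Lemma lebesgue_cube v (l : R) : 0 < l ->
  mu (cube v l) = ((l ^+ n)%:E * mu (cube 0 1))%E.
Proof.
by move=> l0; rewrite cube_affine// lebesgue_affine ?invr_gt0// exprVn invrK.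
Qed.

Lemma cube_cover x : exists k : nat, forall k' : nat, (k <= k')%N ->
  cube (const_mx (- k'%:R)) (2 * k'%:R) x.
Proof.
have [k xk] : exists k : nat, \sum_i `|x 0 i| < k%:R.
  by exists (Num.truncn (\sum_i `|x 0 i|)).+1; exact: truncnS_gt.
exists k => k' kk' i; rewrite !mxE.
suff : `|x 0 i| < k'%:R by rewrite ltr_norml => /andP[? ?]; apply/andP; split; lra.
apply: (@lt_le_trans _ _ k%:R); last by rewrite ler_nat.
apply: le_lt_trans xk; rewrite (bigD1 i)//= lerDl.
by apply: sumr_ge0.
Qed.

Lemma lebesgue_sigma_finite : sigma_finite [set: Leb R n] mu.
Proof.
exists (fun k => cube (const_mx (- k%:R)) (2 * k%:R)).
  by apply/seteqP; split => // x _; have [k xk] := cube_cover x; exists k => //; exact: xk.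
move=> k; split; first exact: measurable_box.
by apply: le_lt_trans (lebesgue_cube_le _ _) _; rewrite ?ltry// mulr_ge0.
Qed.

(** The same measure bundled with sigma-finiteness, as Tonelli and Fubini require. *)
Definition lebesgue_sf : {sigma_finite_measure set (Leb R n) -> \bar R} :=
  HB.pack (mu : set (Leb R n) -> \bar R) (Measure.class mu)
    (Measure_isSigmaFinite.Build _ _ _ _ lebesgue_sigma_finite).

(** The pushforward of the measure under the affine map is [l ^- n] times the measure. *)
Lemma ge0_integral_affine (f : 'rV[R]_n -> \bar R) (l : R) v : 0 < l ->
  (forall x, 0 <= f x)%E -> measurable_fun [set: Leb R n] (f : Leb R n -> _) ->
  (\int[mu]_(x in [set: Leb R n]) f (affine l v x) =
   (l ^- n)%:E * \int[mu]_(x in [set: Leb R n]) f x)%E.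
Proof.
move=> l0 f0 mf; have ln : 0 <= l ^- n by rewrite invr_ge0 exprn_ge0// ltW.
have mA := measurable_affine v l0.
transitivity (\int[pushforward mu (affine l v : Leb R n -> Leb R n)]_(x in
    [set: Leb R n]) f x)%E.
  by rewrite ge0_integral_pushforward.
rewrite (eq_measure_integral (mscale (NngNum ln) mu)).
  by rewrite ge0_integral_mscale.
by move=> A mA' _; exact: lebesgue_affine.
Qed.

Lemma Lintegrable_affine f (l : R) v : 0 < l -> Lintegrable f ->
  Lintegrable (f \o affine l v).
Proof.
move=> l0 /integrableP[mf foo]; apply/integrableP; split.
  exact: (measurableT_comp mf (measurable_affine v l0)).
have mF : measurable_fun [set: Leb R n] (fun x : Leb R n => `|(f x)%:E|%E).
  exact: (measurableT_comp (@abse_measurable _ _) mf).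
have F0 x : (0 <= `|(f x)%:E|)%E by exact: abse_ge0.
have fE := ge0_integral_affine v l0 F0 mF.
apply: (@eq_ind_r _ _ (fun z => z < +oo)%E _ _ fE).
by rewrite lte_mul_pinfty// ?lee_fin ?invr_ge0 ?exprn_ge0// ltW.
Qed.

Lemma Lint_affine f (l : R) v : 0 < l -> Lintegrable f ->
  Lint (f \o affine l v) = l ^- n * Lint f.
Proof.
move=> l0 fi; have mf := Lintegrable_meas fi.
have ln : 0 < l ^- n by rewrite invr_gt0 exprn_gt0.
rewrite /Lint /Rintegral.
pose F x : \bar R := (f x)%:E.
have mfE : measurable_fun [set: Leb R n] (F : Leb R n -> _) by exact/measurable_EFinP.
have -> : (\int[mu]_(x in [set: Leb R n]) ((f \o affine l v) x)%:E =
    (l ^- n)%:E * \int[mu]_(x in [set: Leb R n]) F x)%E.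
  rewrite [in LHS]integralE [in RHS]integralE.
  rewrite muleBr//; last exact: integrable_add_def.
  rewrite -(@ge0_integral_affine F^\+%E l v)//; last exact: measurable_funepos.
  rewrite -(@ge0_integral_affine F^\-%E l v)//; last exact: measurable_funeneg.
  by rewrite -/(F \o affine l v) funepos_comp funeneg_comp.
by rewrite fineM//; exact: integrable_fin_num.
Qed.

(* The majorant is the sum over [j] of [2^-(j(n+1))] times the indicator of the
   cube [-2^j, 2^j)^n, whose integral is a geometric series. *)
Lemma Lintegrable_decay f (C : R) : Lmeas f ->
  (forall x, `|f x| <= C) -> (forall x i, `|f x| * `|x 0 i| ^+ n.+1 <= C) ->
  Lintegrable f.
Proof.
move=> mf fC fxC.
pose A j := cube (const_mx (- 2 ^+ j)) (2 * 2 ^+ j).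
have C0 : 0 <= C by apply: le_trans (fC 0).
have mA j : measurable (A j : set (Leb R n)) by exact: measurable_box.
pose c j : R := (2 ^- j) ^+ n.+1.
have c0 j : 0 <= c j by rewrite exprn_ge0// invr_ge0 exprn_ge0.
apply: (@integrable_le_steps _ _ _ mu f c A (C * 2 ^+ n.+1)) => //.
- by rewrite mulr_ge0 ?exprn_ge0.
- apply: (@le_lt_trans _ _ (\sum_(j <oo) (2 ^+ n.+1 / (2 ^ j.+1)%:R)%:E)%E); last first.
    by apply: le_lt_trans (epsilon_trick0 _ _) (ltry _); rewrite exprn_ge0.
  apply: lee_nneseries => [j _ _|j _]; first by rewrite mule_ge0 ?lee_fin.
  apply: (@le_trans _ _ (((2 ^- j) ^+ n.+1)%:E * ((2 * 2 ^+ j) ^+ n)%:E)%E).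
    apply: lee_wpmul2l; first by rewrite lee_fin exprn_ge0// invr_ge0 exprn_ge0.
    by apply: lebesgue_cube_le; rewrite mulr_ge0// exprn_ge0.
  rewrite -EFinM lee_fin le_eqVlt; apply/orP; left; apply/eqP.
  rewrite natrX !exprS exprVn exprMn; field.
  by rewrite !expf_eq0 ?pnatr_eq0 /= !andbF.
move=> x.
have : exists j, `[< A j x >].
  have [k xk] := cube_cover x; exists k; apply/asboolP.
  have := xk (2 ^ k)%N; rewrite natrX; apply.
  by apply: ltnW; exact: ltn_expl.
(* With the smallest cube containing [x], lying outside the previous cube forces a coordinate of
   size at least half of [2 ^+ j]; the decay of [f] in that coordinate gives the bound. *)
move=> /ex_minnP[j /asboolP Ajx minj]; exists j; split => //.
case: j Ajx minj => [|j] Ajx minj.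
  rewrite /c expr0 invr1 expr1n mulr1; apply: le_trans (fC x) _.
  by rewrite ler_peMr// exprn_ege1// ler1n.
have nA : ~ A j x by move=> /asboolP /minj; rewrite ltnn.
have [i xi] : exists i, 2 ^+ j <= `|x 0 i|.
  apply: contrapT => nx; apply: nA => i; rewrite !mxE.
  have : `|x 0 i| < 2 ^+ j by rewrite ltNge; apply/negP => h; apply: nx; exists i.
  by rewrite ltr_norml => /andP[? ?]; apply/andP; split; lra.
have p0 : (0:R) < 2 ^+ j by rewrite exprn_gt0.
rewrite /c [2 ^+ j.+1]exprS invfM exprMn mulrA -[C * _ * _]mulrA -exprMn mulfV// expr1n mulr1.
rewrite exprVn ler_pdivlMr ?exprn_gt0//.
by apply: le_trans (fxC x i); rewrite ler_wpM2l// lerXn2r ?nnegrE// ltW.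
Qed.

End lebesgue_integral_on_Rn.

(** * Gaussians *)

Section gaussian.
Context {R : realType} {n : nat}.
Implicit Types (x y v : 'rV[R]_n) (p q : 'rV[R]_n -> R).

Lemma dotvC x y : dotv x y = dotv y x.
Proof. by apply: eq_bigr => i _; rewrite mulrC. Qed.

Lemma dotvDl x y v : dotv (x + y) v = dotv x v + dotv y v.
Proof. by rewrite /dotv -big_split; apply: eq_bigr => i _; rewrite mxE mulrDl. Qed.

Lemma dotvZl (l : R) x v : dotv (l *: x) v = l * dotv x v.
Proof. by rewrite /dotv mulr_sumr; apply: eq_bigr => i _; rewrite mxE mulrA. Qed.

Lemma dotvNl x v : dotv (- x) v = - dotv x v.
Proof. by rewrite -scaleN1r dotvZl mulN1r. Qed.

Lemma dotvDr x y v : dotv v (x + y) = dotv v x + dotv v y.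
Proof. by rewrite dotvC dotvDl !(dotvC v). Qed.

Lemma dotvZr (l : R) x v : dotv v (l *: x) = l * dotv v x.
Proof. by rewrite dotvC dotvZl (dotvC v). Qed.

Lemma dotv_ge0 x : 0 <= dotv x x.
Proof. by apply: sumr_ge0 => i _; rewrite -expr2 sqr_ge0. Qed.

Lemma sqr_coord_le_dotv x i : x 0 i ^+ 2 <= dotv x x.
Proof.
rewrite /dotv (bigD1 i)//= -expr2 lerDl.
by apply: sumr_ge0 => j _; rewrite -expr2 sqr_ge0.
Qed.

Lemma dotv_shift_ge x v : dotv x x / 2 - dotv v v <= dotv (x + v) (x + v).
Proof.
rewrite /dotv mulr_suml -sumrB; apply: ler_sum => i _; rewrite !mxE.
rewrite -subr_ge0.
rewrite (_ : _ - _ = (x 0 i + 2 * v 0 i) ^+ 2 / 2); last by field.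
by rewrite divr_ge0// sqr_ge0.
Qed.

Lemma continuous_mul p q : continuous p -> continuous q ->
  continuous (fun x => p x * q x).
Proof. by move=> cp cq x; exact: (@continuousM R _ p q x (cp x) (cq x)). Qed.

(** Polynomial functions as a predicate: continuity, growth and differentiation all follow by
    induction on the construction, without coefficients or degrees. *)
Inductive polyfun : ('rV[R]_n -> R) -> Prop :=
| polyfun_cst (c : R) : polyfun (fun=> c)
| polyfun_coord (i : 'I_n) : polyfun (fun x => x 0 i)
| polyfun_add p q : polyfun p -> polyfun q -> polyfun (fun x => p x + q x)
| polyfun_mul p q : polyfun p -> polyfun q -> polyfun (fun x => p x * q x).

Lemma polyfun_sum (I : Type) (r : seq I) (p : I -> 'rV[R]_n -> R) :
  (forall i, polyfun (p i)) -> polyfun (fun x => \sum_(i <- r) p i x).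
Proof.
move=> pp; elim: r => [|i r IH].
  by under eq_fun do rewrite big_nil; exact: polyfun_cst.
by under eq_fun do rewrite big_cons; exact: polyfun_add.
Qed.

Lemma polyfun_prod (I : Type) (r : seq I) (p : I -> 'rV[R]_n -> R) :
  (forall i, polyfun (p i)) -> polyfun (fun x => \prod_(i <- r) p i x).
Proof.
move=> pp; elim: r => [|i r IH].
  by under eq_fun do rewrite big_nil; exact: polyfun_cst.
by under eq_fun do rewrite big_cons; exact: polyfun_mul.
Qed.

Lemma polyfun_exp p (k : nat) : polyfun p -> polyfun (fun x => p x ^+ k).
Proof.
move=> pp; elim: k => [|k IH].
  by under eq_fun do rewrite expr0; exact: polyfun_cst.
by under eq_fun do rewrite exprS; exact: polyfun_mul.
Qed.

Lemma polyfun_dotv v : polyfun (fun x => dotv x v).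
Proof.
apply: polyfun_sum => i; apply: polyfun_mul; last exact: polyfun_cst.
exact: polyfun_coord.
Qed.

Lemma polyfun_sqnorm : polyfun (fun x => dotv x x).
Proof. by apply: polyfun_sum => i; apply: polyfun_mul; exact: polyfun_coord. Qed.

Lemma polyfun_continuous p : polyfun p -> continuous p.
Proof.
elim=> {p} [c|i|p q _ cp _ cq|p q _ cp _ cq] x.
- exact: (@cst_continuous _ _ c x).
- exact: (@coord_continuous R 1 n 0 i x).
- exact: (@continuousD R _ _ p q x (cp x) (cq x)).
- exact: continuous_mul.
Qed.

(** Quantifying over every [e] carries the induction through products, where each factor is given
    [e / 2]. Coordinates are handled by [|t| <= 1 + t^2] and [1 + s <= expR s]. *)
Lemma polyfun_bound p (e : R) : 0 < e -> polyfun p ->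
  exists2 C : R, 0 <= C & forall x, `|p x| <= C * expR (e * dotv x x).
Proof.
move=> + pp; elim: pp e => {p} [c|i|p q _ Hp _ Hq|p q _ Hp _ Hq] e e0.
- exists `|c| => // x; rewrite ler_peMr// -expR0 ler_expR.
  by rewrite mulr_ge0// ?dotv_ge0// ltW.
- have c0 : 0 <= 1 + e^-1 by rewrite addr_ge0// invr_ge0 ltW.
  exists (1 + e^-1) => // x.
  apply: (@le_trans _ _ ((1 + e^-1) * (1 + e * dotv x x))); last first.
    by rewrite ler_wpM2l// expR_ge1Dx.
  have ex := sqr_coord_le_dotv x i.
  have -> : (1 + e^-1) * (1 + e * dotv x x) = 1 + e^-1 + e * dotv x x + dotv x x.
    by field; rewrite gt_eqF.
  have e'0 : 0 <= e^-1 by rewrite invr_ge0 ltW.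
  have ed : 0 <= e * dotv x x by rewrite mulr_ge0// ?dotv_ge0// ltW.
  have : `|x 0 i| <= 1 + `|x 0 i| ^+ 2.
    have h1 := sqr_ge0 (`|x 0 i| - 1); have h2 := sqr_ge0 `|x 0 i|.
    rewrite sqrrB1 in h1; lra.
  by rewrite real_normK ?num_real//; lra.
- have [C C0 pC] := Hp _ e0; have [D D0 qD] := Hq _ e0.
  exists (C + D) => [|x]; first exact: addr_ge0.
  by rewrite mulrDl (le_trans (ler_normD _ _))// lerD.
- have e2 : 0 < e / 2 by rewrite divr_gt0.
  have [C C0 pC] := Hp _ e2; have [D D0 qD] := Hq _ e2.
  exists (C * D) => [|x]; first exact: mulr_ge0.
  have -> : e * dotv x x = e / 2 * dotv x x + e / 2 * dotv x x by field.
  by rewrite expRD mulrACA normrM ler_pM.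
Qed.

Lemma continuous_gauss (s : R) : continuous (fun x => expR (- (s * dotv x x))).
Proof.
have pf : polyfun (fun x => -1 * (s * dotv x x)).
  apply: polyfun_mul; first exact: polyfun_cst.
  apply: polyfun_mul; first exact: polyfun_cst.
  exact: polyfun_sqnorm.
have -> : (fun x => expR (- (s * dotv x x))) = expR \o (fun x => -1 * (s * dotv x x)).
  by apply/funext => x /=; rewrite mulN1r.
move=> x; apply: continuous_comp; first exact: polyfun_continuous.
exact: continuous_expR.
Qed.

Lemma polyfun_gauss_bound p (s : R) : 0 < s -> polyfun p ->
  exists2 C : R, 0 <= C & forall x, `|p x * expR (- (s * dotv x x))| <= C.
Proof.
move=> s0 pp; have [C C0 pC] := polyfun_bound s0 pp; exists C => // x.
by rewrite normrM (ger0_norm (expR_ge0 _)) expRN ler_pdivrMr ?expR_gt0.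
Qed.

Lemma Lintegrable_polyfun_gauss p (s : R) : 0 < s -> polyfun p ->
  Lintegrable (fun x => p x * expR (- (s * dotv x x))).
Proof.
move=> s0 pp.
have [C C0 HC] := polyfun_gauss_bound s0 pp.
have H i : exists D, 0 <= D /\ forall x : 'rV[R]_n,
    `|p x * expR (- (s * dotv x x))| * `|x 0 i| ^+ n.+1 <= D.
  have [|D D0 HD] := @polyfun_gauss_bound (fun x => p x * x 0 i ^+ n.+1) s s0.
    by apply: polyfun_mul => //; apply: polyfun_exp; exact: polyfun_coord.
  by exists D; split => // x; rewrite -normrX -normrM mulrAC.
pose D i := sval (cid (H i)).
have D0 i : 0 <= D i by exact: (svalP (cid (H i))).1.
have HD i x : `|p x * expR (- (s * dotv x x))| * `|x 0 i| ^+ n.+1 <= D i.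
  exact: (svalP (cid (H i))).2.
have SD : 0 <= \sum_i D i by exact: sumr_ge0.
apply: (@Lintegrable_decay _ _ _ (C + \sum_i D i)).
- apply: continuous_Lmeas; apply: continuous_mul; first exact: polyfun_continuous.
  exact: continuous_gauss.
- by move=> x; rewrite (le_trans (HC x))// lerDl.
- move=> x i; rewrite (le_trans (HD i x))// (bigD1 i)//= addrCA lerDl.
  by rewrite addr_ge0// sumr_ge0.
Qed.

Lemma is_derive_line p x v (df : R) :
  is_derive (0 : R) 1 (fun t : R => p (t *: v + x)) df -> is_derive x v p df.
Proof.
have E : (fun h : R => h^-1 *: (p (h *: v + x) - p x)) =
    (fun h : R => h^-1 *: (p ((h *: 1 + 0) *: v + x) - p (0 *: v + x))).
  by apply/funext => h; rewrite addr0 scale0r add0r [h *: 1]mulr1.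
case=> [d1 d2]; split.
  by move: d1; rewrite /derivable E.
by move: d2; rewrite /derive E.
Qed.

Lemma is_derive_coord_line x v i (t : R) :
  is_derive t (1 : R) (fun t : R => (t *: v + x) 0 i) (v 0 i).
Proof.
have -> : (fun t : R => (t *: v + x) 0 i) = (id * cst (v 0 i)) + cst (x 0 i).
  by apply/funext => u /=; rewrite !mxE.
by apply: is_derive_eq; rewrite scaler0 add0r addr0 [_ *: _]mulr1.
Qed.

Lemma is_derive_polyfun p v : polyfun p ->
  exists2 q, polyfun q & forall x, is_derive x v p (q x).
Proof.
elim => {p} [c|i|p q pp [p' pp' dp] pq [q' pq' dq]|p q pp [p' pp' dp] pq [q' pq' dq]].
- by exists (fun=> 0); [exact: polyfun_cst|move=> x; exact: is_derive_cst].
- exists (fun=> v 0 i); first exact: polyfun_cst.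
  by move=> x; apply: is_derive_line; exact: is_derive_coord_line.
- exists (fun x => p' x + q' x); first exact: polyfun_add.
  by move=> x; exact: (is_deriveD (dp x) (dq x)).
- exists (fun x => p x * q' x + q x * p' x).
    by apply: polyfun_add; exact: polyfun_mul.
  by move=> x; exact: (is_deriveM (dp x) (dq x)).
Qed.

(** The factor 1/2 makes this function its own Fourier transform up to a constant, so symbol and
    kernel have the same shape. *)
Definition gauss x : R := expR (- (2^-1 * dotv x x)).

Lemma gauss_line x v (t : R) :
  gauss (t *: v + x) = expR (- (2^-1 * (t ^+ 2 * dotv v v + 2 * t * dotv x v + dotv x x))).
Proof.
rewrite /gauss !(dotvDl, dotvDr, dotvZl, dotvZr) (dotvC v x).
by congr (expR _); ring.
Qed.

Lemma is_derive_gauss_line x v (t : R) :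
  is_derive t (1:R) (fun t : R => gauss (t *: v + x))
    (- (dotv x v + t * dotv v v) * gauss (t *: v + x)).
Proof.
have -> : (fun t : R => gauss (t *: v + x)) = expR \o
   (fun t => - (2^-1 * (t ^+ 2 * dotv v v + 2 * t * dotv x v + dotv x x))).
  by apply/funext => u /=; rewrite gauss_line.
rewrite gauss_line mulrC; apply: is_derive1_comp.
have -> : (fun t : R => - (2^-1 * (t ^+ 2 * dotv v v + 2 * t * dotv x v + dotv x x)))
  = - ((2^-1) \*: (id ^+ 2 * cst (dotv v v) + (2 \*: id) * cst (dotv x v) + cst (dotv x x))).
  by apply/funext => u.
by apply: is_derive_eq; rewrite /= /GRing.scale/=; field.
Qed.

Lemma is_derive_gauss x v : is_derive x v gauss (- dotv x v * gauss x).
Proof.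
apply: is_derive_line; have := is_derive_gauss_line x v 0.
by rewrite mul0r addr0 scale0r add0r.
Qed.

Lemma dpart_gauss (l : seq 'I_n) :
  exists2 p, polyfun p & dpart l gauss = (fun x => p x * gauss x).
Proof.
elim: l => [|i l [p pp lp]].
  by exists (fun=> 1); [exact: polyfun_cst|apply/funext => x; rewrite mul1r].
have [q pq dp] := is_derive_polyfun (delta_mx 0 i) pp.
exists (fun x => p x * (-1 * dotv x (delta_mx 0 i)) + q x).
  apply: polyfun_add => //; apply: polyfun_mul => //.
  by apply: polyfun_mul; [exact: polyfun_cst|exact: polyfun_dotv].
apply/funext => x /=; rewrite lp.
have := is_deriveM (dp x) (is_derive_gauss x (delta_mx 0 i)).
move=> /@derive_val ->; rewrite /GRing.scale/=; ring.
Qed.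

Lemma rschwartz_gauss : rschwartz gauss.
Proof.
move=> l; have [p pp ->] := dpart_gauss l; split; [|split].
- apply: continuous_mul; first exact: polyfun_continuous.
  exact: continuous_gauss.
- move=> i x; have [q _ dp] := is_derive_polyfun (delta_mx 0 i) pp.
  by have [] := is_deriveM (dp x) (is_derive_gauss x (delta_mx 0 i)).
- move=> alpha; have h : (0 : R) < 2^-1 by rewrite invr_gt0.
  have [|C C0 HC] := @polyfun_gauss_bound
    (fun x => \prod_(i < n) x 0 i ^+ alpha i * p x) _ h.
    apply: polyfun_mul => //; apply: polyfun_prod => i.
    by apply: polyfun_exp; exact: polyfun_coord.
  by exists C => x; rewrite mulrA; exact: HC.
Qed.

End gaussian.

(** * The Fourier transform of the Gaussian *)

Section differentiation_under_the_integral_sign.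
Context {d} {T : measurableType d} {R : realType} (mu : {measure set T -> \bar R}).

Lemma is_derive_Rintegral (f df : R -> T -> R) (G : T -> R) (a : R) :
  (forall t, mu.-integrable [set: T] (EFin \o f t)) ->
  (forall t x, is_derive t (1 : R) (f^~ x) (df t x)) ->
  mu.-integrable [set: T] (EFin \o G) ->
  (forall t x, `|t - a| < 1 -> `|df t x| <= G x) ->
  is_derive a (1 : R) (fun t => \int[mu]_(x in [set: T]) f t x)
    (\int[mu]_(x in [set: T]) df a x).
Proof.
move=> fi dfE Gi dfG.
have Ia : `]a - 1, a + 1[%classic a by rewrite /= in_itv/= ltrBlDr !ltrDl ltr01.
have fi' t : `]a - 1, a + 1[%classic t -> mu.-integrable [set: T] (EFin \o f t) by [].
have der t x : `]a - 1, a + 1[%classic t -> [set: T] x -> derivable (f^~ x) t 1.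
  by move=> _ _; have [] := dfE t x.
have G0 x : 0 <= G x by apply: le_trans (dfG a x _) => //; rewrite subrr normr0.
have dE t x : derive1 (f^~ x) t = df t x.
  by rewrite derive1E; have [_ ->] := dfE t x.
have Gb t x : `]a - 1, a + 1[%classic t -> [set: T] x -> `|derive1 (f^~ x) t| <= G x.
  rewrite /= in_itv/= => /andP[t1 t2] _; rewrite dE; apply: dfG.
  by rewrite ltr_norml; apply/andP; split; lra.
have D1 := @derivable_under_integral _ _ _ mu f _ measurableT _ _ _ Ia fi' der G G0 Gi Gb.
have D2 := @differentiation_under_integral _ _ _ mu f _ measurableT _ _ _ Ia fi' der G G0 Gi Gb.
split => //; rewrite -derive1E D2; apply: eq_Rintegral => x _; exact: dE.
Qed.

Lemma le_integrable_real (f g : T -> R) : measurable_fun [set: T] f ->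
  mu.-integrable [set: T] (EFin \o g) -> (forall x, `|f x| <= g x) ->
  mu.-integrable [set: T] (EFin \o f).
Proof.
move=> mf ig fg; apply: le_integrable ig => //; first exact/measurable_EFinP.
by move=> x _ /=; rewrite lee_fin (le_trans (fg x))// ler_norm.
Qed.

Lemma integrableD_real (f g : T -> R) :
  mu.-integrable [set: T] (EFin \o f) -> mu.-integrable [set: T] (EFin \o g) ->
  mu.-integrable [set: T] (EFin \o (fun x => f x + g x)).
Proof. by move=> fi gi; apply: (eq_integrable _ _ _ _ (integrableD measurableT fi gi)). Qed.

Lemma integrableZ_real (f : T -> R) (k : R) :
  mu.-integrable [set: T] (EFin \o f) ->
  mu.-integrable [set: T] (EFin \o (fun x => k * f x)).
Proof. by move=> fi; apply: (eq_integrable _ _ _ _ (integrableZl measurableT k fi)). Qed.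

End differentiation_under_the_integral_sign.

Section gaussian_fourier.
Context {R : realType} {n : nat}.
Implicit Types (x y v xi : 'rV[R]_n) (p q f g : 'rV[R]_n -> R).

Lemma Lintegrable_le f g : Lmeas f -> Lintegrable g -> (forall x, `|f x| <= g x) ->
  Lintegrable f.
Proof. exact: le_integrable_real. Qed.

Lemma LintegrableD f g : Lintegrable f -> Lintegrable g ->
  Lintegrable (fun x => f x + g x).
Proof. exact: integrableD_real. Qed.

Lemma LintegrableZ f (k : R) : Lintegrable f -> Lintegrable (fun x => k * f x).
Proof. exact: integrableZ_real. Qed.

Lemma LintD f g : Lintegrable f -> Lintegrable g ->
  Lint (fun x => f x + g x) = Lint f + Lint g.
Proof. exact: RintegralD. Qed.

Lemma LintZ f (k : R) : Lintegrable f -> Lint (fun x => k * f x) = k * Lint f.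
Proof. by move=> fi; exact: RintegralZl. Qed.

Lemma continuous_phase (F : R -> R) (t th : R) xi : continuous F ->
  continuous (fun x => F (t * dotv x xi + th)).
Proof.
move=> cF x; apply: (@continuous_comp _ _ _ (fun x => t * dotv x xi + th) F).
  apply: polyfun_continuous; apply: polyfun_add; last exact: polyfun_cst.
  by apply: polyfun_mul; [exact: polyfun_cst|exact: polyfun_dotv].
exact: cF.
Qed.

Lemma continuous_gauss1 : continuous (@gauss R n).
Proof. exact: continuous_gauss. Qed.

Lemma Lintegrable_gauss_le f p : polyfun p -> continuous f ->
  (forall x, `|f x| <= p x) -> Lintegrable (fun x => f x * gauss x).
Proof.
move=> pp cf fp; apply: (Lintegrable_le (g := fun x => p x * gauss x)).
- apply: continuous_Lmeas; apply: continuous_mul => //; exact: continuous_gauss1.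
- by apply: Lintegrable_polyfun_gauss => //; rewrite invr_gt0.
- by move=> x; rewrite normrM (ger0_norm (expR_ge0 _)) ler_wpM2r ?expR_ge0.
Qed.

Lemma normr_le_sqr (t : R) : `|t| <= 1 + t ^+ 2.
Proof.
have h1 := sqr_ge0 (`|t| - 1); have h2 := sqr_ge0 `|t|.
rewrite sqrrB1 in h1; rewrite -(real_normK (num_real t)); lra.
Qed.

(** Half of the exponent is given up for a Gaussian in [x] alone, uniform over bounded [v]. It
    dominates translates both under the derivative sign and in convolutions. *)
Lemma gauss_shift_le v x : gauss (v + x) <=
  expR (2^-1 * dotv v v) * expR (- (4^-1 * dotv x x)).
Proof.
rewrite -expRD ler_expR [v + x]addrC.
by have := dotv_shift_ge x v; lra.
Qed.

Lemma Lintegrable_gauss_trig (F : R -> R) (t th : R) xi : continuous F ->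
  (forall u, `|F u| <= 1) ->
  Lintegrable (fun x => F (t * dotv x xi + th) * gauss x).
Proof.
move=> cF F1; apply: (Lintegrable_gauss_le (p := fun=> 1)) => //.
- exact: polyfun_cst.
- exact: continuous_phase.
Qed.

Lemma Lintegrable_dotv_gauss_trig (F : R -> R) (t th : R) xi : continuous F ->
  (forall u, `|F u| <= 1) ->
  Lintegrable (fun x => dotv x xi * F (t * dotv x xi + th) * gauss x).
Proof.
move=> cF F1.
apply: (Lintegrable_gauss_le (p := fun x => 1 + dotv x xi ^+ 2)) => //.
- apply: polyfun_add; first exact: polyfun_cst.
  by apply: polyfun_exp; exact: polyfun_dotv.
- apply: continuous_mul; last exact: continuous_phase.
  by apply: polyfun_continuous; exact: polyfun_dotv.
- move=> x; rewrite normrM (le_trans _ (normr_le_sqr _))//.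
  by rewrite ler_piMr.
Qed.

(* Integration by parts: the integral of [sin (t <x, xi> + th) * gauss x] over
   translates along [xi] is constant, so its derivative vanishes. *)
Lemma Lint_dotv_sin_gauss (t th : R) xi :
  Lint (fun x => dotv x xi * sin (t * dotv x xi + th) * gauss x) =
  t * dotv xi xi * Lint (fun x => cos (t * dotv x xi + th) * gauss x).
Proof.
pose F x := sin (t * dotv x xi + th) * gauss x.
have Fi : Lintegrable F.
  by apply: Lintegrable_gauss_trig; [exact: continuous_sin|exact: sin_max].
pose f s x := F (s *: xi + x).
have fE s : f s = F \o affine 1 (s *: xi).
  by apply/funext => x; rewrite /f /affine /= scale1r addrC.
have fi s : Lintegrable (f s) by rewrite fE; exact: Lintegrable_affine.
have If s : Lint (f s) = Lint F.
  by rewrite fE Lint_affine// expr1n invr1 mul1r.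
pose df s x := (- (dotv x xi + s * dotv xi xi) *
    sin (t * (s * dotv xi xi + dotv x xi) + th) +
   t * dotv xi xi * cos (t * (s * dotv xi xi + dotv x xi) + th)) * gauss (s *: xi + x).
have dfE s x : is_derive s (1 : R) (f^~ x) (df s x).
  have D1 : is_derive s (1 : R) (fun s => sin (t * (s * dotv xi xi + dotv x xi) + th))
     (cos (t * (s * dotv xi xi + dotv x xi) + th) * (t * dotv xi xi)).
    apply: (is_derive1_comp (f := sin) (g := fun s => t * (s * dotv xi xi + dotv x xi) + th)).
    have -> : (fun s : R => t * (s * dotv xi xi + dotv x xi) + th) =
       t \*: (id * cst (dotv xi xi) + cst (dotv x xi)) + cst th by [].
    by apply: is_derive_eq; rewrite /= /GRing.scale/=; ring.
  have D := is_deriveM D1 (is_derive_gauss_line x xi s).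
  have -> : f^~ x = (fun s => sin (t * (s * dotv xi xi + dotv x xi) + th)) *
      (fun s : R => gauss (s *: xi + x)).
    by apply/funext => u; rewrite /f /F dotvDl dotvZl.
  by apply: is_derive_eq; rewrite /df /GRing.scale/=; ring.
pose c := dotv xi xi.
have c0 : 0 <= c by exact: dotv_ge0.
(* A majorant of [df s] for [|s| < 1]: the exponential comes from [gauss_shift_le] with shift
   [s *: xi], the other terms bound the two trigonometric coefficients. *)
pose p x := expR (2^-1 * c) * (1 + dotv x xi ^+ 2 + c + `|t| * c).
pose G x := p x * expR (- (4^-1 * dotv x x)).
have Gi : Lintegrable G.
  apply: Lintegrable_polyfun_gauss; first by rewrite invr_gt0.
  apply: polyfun_mul; first exact: polyfun_cst.
  apply: polyfun_add; last exact: polyfun_cst.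
  apply: polyfun_add; last exact: polyfun_cst.
  apply: polyfun_add; first exact: polyfun_cst.
  by apply: polyfun_exp; exact: polyfun_dotv.
have dfG s x : `|s - 0| < 1 -> `|df s x| <= G x.
  rewrite subr0 => s1; rewrite /df /G /p normrM.
  rewrite [X in _ <= X](_ : _ = (1 + dotv x xi ^+ 2 + c + `|t| * c) *
    (expR (2^-1 * c) * expR (- (4^-1 * dotv x x)))); last by ring.
  apply: ler_pM => //; last first.
    rewrite (ger0_norm (expR_ge0 _)); apply: (le_trans (gauss_shift_le _ _)).
    rewrite ler_pM2r ?expR_gt0// ler_expR dotvZl dotvZr mulrA -expr2.
    rewrite ler_pM2l ?invr_gt0// ler_piMl// -real_normK ?num_real//.
    by rewrite exprn_ile1// ltW.
  rewrite (le_trans (ler_normD _ _))// lerD//.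
    rewrite normrM normrN (le_trans (_ : _ <= `|dotv x xi + s * c|))//.
      by rewrite ler_piMr// sin_max.
    rewrite (le_trans (ler_normD _ _))// lerD ?normr_le_sqr//.
    by rewrite normrM (ger0_norm c0) ler_piMl// ltW.
  by rewrite !normrM (ger0_norm c0) ler_piMr ?mulr_ge0// cos_max.
have := is_derive_Rintegral (mu := lebesgue R n) fi dfE Gi dfG.
have -> : (fun s => \int[lebesgue R n]_(x in [set: Leb R n]) f s x) = cst (Lint F).
  by apply/funext => s; exact: If.
move=> [_]; rewrite derive_cst => /esym.
have s1 : Lintegrable (fun x => dotv x xi * sin (t * dotv x xi + th) * gauss x).
  by apply: Lintegrable_dotv_gauss_trig; [exact: continuous_sin|exact: sin_max].
have s2 : Lintegrable (fun x => cos (t * dotv x xi + th) * gauss x).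
  by apply: Lintegrable_gauss_trig; [exact: continuous_cos|exact: cos_max].
have -> : df 0 = (fun x => -1 * (dotv x xi * sin (t * dotv x xi + th) * gauss x) +
   (t * dotv xi xi) * (cos (t * dotv x xi + th) * gauss x)).
  by apply/funext => x; rewrite /df !mul0r addr0 add0r scale0r add0r; ring.
rewrite -/(Lint _) LintD; [|exact: LintegrableZ|exact: LintegrableZ].
by rewrite !LintZ// mulN1r addrC => /eqP; rewrite subr_eq0 => /eqP ->.
Qed.

Definition gauss_mass : R := Lint (@gauss R n).

(** The phase [th] lets one formula serve both parts of the complex exponential: phase 0 gives the
    real part, phase [pi / 2] minus the imaginary part. *)
Lemma Lint_cos_gauss (th : R) xi :
  Lint (fun x => cos (dotv x xi + th) * gauss x) = cos th * gauss_mass * gauss xi.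
Proof.
pose h (t : R) := Lint (fun x => cos (t * dotv x xi + th) * gauss x).
pose c := dotv xi xi.
have dh t : is_derive t (1 : R) h (- (t * c) * h t).
  have D s x : is_derive s (1 : R) (fun s => cos (s * dotv x xi + th) * gauss x)
     (- (dotv x xi * sin (s * dotv x xi + th) * gauss x)).
    have -> : (fun s : R => cos (s * dotv x xi + th) * gauss x) =
       (gauss x) \*: (cos \o (fun s => s * dotv x xi + th)).
      by apply/funext => u /=; rewrite mulrC.
    have -> : - (dotv x xi * sin (s * dotv x xi + th) * gauss x) =
      gauss x *: ((- sin (s * dotv x xi + th)) * dotv x xi) by rewrite /GRing.scale/=; ring.
    apply: is_deriveZ; apply: is_derive1_comp.
    have -> : (fun s : R => s * dotv x xi + th) = id * cst (dotv x xi) + cst th by [].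
    by apply: is_derive_eq; rewrite /= /GRing.scale/=; ring.
  have fi s : Lintegrable (fun x => cos (s * dotv x xi + th) * gauss x).
    by apply: Lintegrable_gauss_trig; [exact: continuous_cos|exact: cos_max].
  have Gi : Lintegrable (fun x => (1 + dotv x xi ^+ 2) * gauss x).
    apply: Lintegrable_polyfun_gauss; first by rewrite invr_gt0.
    apply: polyfun_add; first exact: polyfun_cst.
    by apply: polyfun_exp; exact: polyfun_dotv.
  have si s : Lintegrable (fun x => dotv x xi * sin (s * dotv x xi + th) * gauss x).
    by apply: Lintegrable_dotv_gauss_trig; [exact: continuous_sin|exact: sin_max].
  have := is_derive_Rintegral (mu := lebesgue R n) (a := t) fi D Gi.
  have -> : - (t * c) * h t =
     Lint (fun x => - (dotv x xi * sin (t * dotv x xi + th) * gauss x)).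
    under eq_fun do rewrite -mulN1r.
    by rewrite LintZ// Lint_dotv_sin_gauss mulN1r mulNr.
  apply => s x _; rewrite normrN normrM (ger0_norm (expR_ge0 _)) ler_wpM2r ?expR_ge0//.
  by rewrite normrM (le_trans _ (normr_le_sqr _))// ler_piMr// sin_max.
(* The integrating factor of the differential equation: [h * E] has zero derivative, and comparing
   its values at 1 and 0 gives the formula. *)
pose E (t : R) := expR (2^-1 * t ^+ 2 * c).
have dE (t : R) : is_derive t (1 : R) E (E t * (t * c)).
  apply: (is_derive1_comp (f := expR) (g := fun t => 2^-1 * t ^+ 2 * c)).
  have -> : (fun t : R => 2^-1 * t ^+ 2 * c) = (2^-1 \*: (id ^+ 2)) * cst c by [].
  by apply: is_derive_eq; rewrite /= /GRing.scale/=; field.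
have d0 (t : R) : is_derive t (1 : R) (h * E) 0.
  have D := is_deriveM (dh t) (dE t).
  by apply: is_derive_eq; rewrite /GRing.scale/=; ring.
have hE : h 1 * E 1 = h 0 * E 0 := is_derive_0_is_cst 1 0 d0.
rewrite /E expr1n expr0n/= !(mulr1, mulr0, mul0r, expR0) in hE.
have -> : Lint (fun x => cos (dotv x xi + th) * gauss x) = h 1.
  by congr Lint; apply/funext => x; rewrite mul1r.
have h0 : h 0 = cos th * gauss_mass.
  rewrite -LintZ; first by congr Lint; apply/funext => x; rewrite mul0r add0r.
  have := Lintegrable_gauss_trig 0 0 xi (@continuous_cos R) (@cos_max R).
  by congr Lintegrable; apply/funext => x; rewrite mul0r addr0 cos0 mul1r.
by rewrite -h0 -hE /gauss -mulrA -expRD -/c subrr expR0 mulr1.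
Qed.

End gaussian_fourier.

(** * Fubini's theorem and complex-valued functions *)

Section dominated_fubini.
Context {d1 d2} {T1 : measurableType d1} {T2 : measurableType d2} {R : realType}.
Variables (m1 : {sigma_finite_measure set T1 -> \bar R})
          (m2 : {sigma_finite_measure set T2 -> \bar R}).
Variables (f : T1 -> T2 -> R) (p : T1 -> R) (q : T2 -> R).
Hypothesis mf : measurable_fun [set: T1 * T2] (fun z => f z.1 z.2).
Hypotheses (p0 : forall x, 0 <= p x) (q0 : forall y, 0 <= q y).
Hypotheses (pi : m1.-integrable [set: T1] (EFin \o p))
           (qi : m2.-integrable [set: T2] (EFin \o q)).
Hypothesis fpq : forall x y, `|f x y| <= p x * q y.

Let mfE : measurable_fun [set: T1 * T2] (fun z => (f z.1 z.2)%:E).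
Proof. exact/measurable_EFinP. Qed.

Lemma integrable_section1 x : m2.-integrable [set: T2] (EFin \o f x).
Proof.
apply: (@le_integrable_real _ _ _ m2 _ (fun y => p x * q y)) => //.
  exact: (measurableT_comp mf (measurable_pair1 x)).
exact: integrableZ_real.
Qed.

Lemma integrable_section2 y : m1.-integrable [set: T1] (EFin \o f^~ y).
Proof.
apply: (@le_integrable_real _ _ _ m1 _ (fun x => q y * p x)) => //.
- exact: (measurableT_comp mf (measurable_pair2 y)).
- exact: integrableZ_real.
- by move=> x; rewrite mulrC.
Qed.

(** By Tonelli, the inner integral of [|f x y|] is at most [p x] times the integral of [q]. Every
    double integral below has a product majorant of this kind. *)
Lemma integrable_dominated :
  (m1 \x m2)%E.-integrable [set: T1 * T2] (fun z => (f z.1 z.2)%:E).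
Proof.
apply/integrable12ltyP => //.
have iq : (\int[m2]_y (q y)%:E < +oo)%E.
  by apply: integrable_lty.
pose Q := Rintegral m2 setT q.
have pQi : m1.-integrable [set: T1] (EFin \o (fun x => p x * Q)).
  have -> : (fun x => p x * Q) = (fun x => Q * p x) by apply/funext => x; rewrite mulrC.
  exact: integrableZ_real.
apply: (@le_lt_trans _ _ (\int[m1]_x (p x * Q)%:E)%E); last first.
  exact: (integrable_lty _ pQi).
apply: ge0_le_integral => //.
- by move=> x _; exact: integral_ge0.
- apply: (measurable_fun_fubini_tonelli_F (fun z => `|(f z.1 z.2)%:E|%E)) => //.
  exact: measurableT_comp.
- apply/measurable_EFinP; apply: measurable_funM => //.
  by apply/measurable_EFinP; exact: measurable_int pi.
move=> x _; rewrite EFinM /Q /Rintegral fineK; last exact: integrable_fin_num.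
rewrite -ge0_integralZl ?lee_fin//; last 2 first.
- exact: measurable_int qi.
- by move=> y _; rewrite lee_fin.
apply: ge0_le_integral => //.
- apply: measurableT_comp => //; exact: (measurableT_comp mfE (measurable_pair1 x)).
- by apply: emeasurable_funM => //; exact: measurable_int qi.
- by move=> y _; rewrite -EFinM lee_fin.
Qed.

Lemma integrable_Rintegral1 : m1.-integrable [set: T1] (EFin \o (fun x => Rintegral m2 setT (f x))).
Proof.
apply: (eq_integrable _ _ _ _ (integrable_fubini_F integrable_dominated)) => //.
by move=> x _; rewrite /= /Rintegral fineK//; exact: (integrable_fin_num _ (integrable_section1 x)).
Qed.

Lemma Rintegral_fubini :
  Rintegral m1 setT (fun x => Rintegral m2 setT (f x)) =
  Rintegral m2 setT (fun y => Rintegral m1 setT (f^~ y)).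
Proof.
rewrite /Rintegral; congr fine.
transitivity (\int[m1]_x \int[m2]_y (f x y)%:E)%E.
  by apply: eq_integral => x _; rewrite fineK//; exact: (integrable_fin_num _ (integrable_section1 x)).
rewrite (Fubini integrable_dominated).
by apply: eq_integral => y _; rewrite fineK//; exact: (integrable_fin_num _ (integrable_section2 y)).
Qed.

End dominated_fubini.

Section complex_numbers.
Context {R : realType}.
Local Open Scope complex_scope.
Implicit Types z w : R[i].

Lemma cpair_eq z : z = cre z +i* cim z. Proof. by case: z. Qed.
Lemma cre_mul z w : cre (z * w) = cre z * cre w - cim z * cim w.
Proof. by case: z; case: w. Qed.
Lemma cim_mul z w : cim (z * w) = cre z * cim w + cim z * cre w.
Proof. by case: z; case: w. Qed.

Lemma cabs_ge0 z : 0 <= cabs z. Proof. exact: sqrtr_ge0. Qed.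

Lemma sqr_cabs z : cabs z ^+ 2 = cre z ^+ 2 + cim z ^+ 2.
Proof. by rewrite /cabs sqr_sqrtr// addr_ge0// sqr_ge0. Qed.

Lemma normr_cre_le z : `|cre z| <= cabs z.
Proof.
by rewrite -(@ler_sqr _ _ _) ?nnegrE ?cabs_ge0// real_normK ?num_real// sqr_cabs lerDl sqr_ge0.
Qed.

Lemma normr_cim_le z : `|cim z| <= cabs z.
Proof.
by rewrite -(@ler_sqr _ _ _) ?nnegrE ?cabs_ge0// real_normK ?num_real// sqr_cabs lerDr sqr_ge0.
Qed.

Lemma cabs_le z : cabs z <= `|cre z| + `|cim z|.
Proof.
rewrite -(@ler_sqr _ _ _) ?nnegrE ?cabs_ge0 ?addr_ge0// sqr_cabs sqrrD.
rewrite !real_normK ?num_real// -addrA [X in _ <= _ + X]addrC lerD2l lerDl.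
by rewrite mulrn_wge0// mulr_ge0.
Qed.

Lemma cabsM z w : cabs (z * w) = cabs z * cabs w.
Proof.
rewrite /cabs -sqrtrM ?addr_ge0 ?sqr_ge0//; congr Num.sqrt.
by rewrite cre_mul cim_mul; ring.
Qed.

Lemma cabs_real (x : R) : cabs x%:C = `|x|.
Proof. by rewrite /cabs /= expr0n/= addr0 sqrtr_sqr. Qed.

Lemma cabs_expi (t : R) : cabs (expi t) = 1.
Proof. by rewrite /cabs /= cos2Dsin2 sqrtr1. Qed.

Lemma expiD (s t : R) : expi (s + t) = expi s * expi t.
Proof.
rewrite [RHS]cpair_eq cre_mul cim_mul /= /expi cosD sinD.
by congr (_ +i* _); rewrite addrC.
Qed.

Lemma realCM (x y : R) : (x * y)%:C = x%:C * y%:C :> R[i].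
Proof. by rewrite [RHS]cpair_eq cre_mul cim_mul /= !mulr0 mul0r subr0 addr0. Qed.

(** Extends [cmeasurable] to arbitrary measurable spaces, since Fubini needs it on the product
    [Leb R n * Leb R n]. *)
Definition cmeas {d} {T : measurableType d} (f : T -> R[i]) :=
  measurable_fun [set: T] (fun x => cre (f x)) /\
  measurable_fun [set: T] (fun x => cim (f x)).

Context {d} {T : measurableType d}.
Implicit Types f g : T -> R[i].

Lemma cmeasM f g : cmeas f -> cmeas g -> cmeas (fun x => f x * g x).
Proof.
move=> [f1 f2] [g1 g2]; split.
  under eq_fun do rewrite cre_mul.
  by apply: measurable_funB; exact: measurable_funM.
under eq_fun do rewrite cim_mul.
by apply: measurable_funD; exact: measurable_funM.
Qed.

Lemma cmeas_real (f : T -> R) : measurable_fun [set: T] f -> cmeas (fun x => (f x)%:C).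
Proof. by move=> mf; split => //=; exact: measurable_cst. Qed.

Lemma cmeas_cst (c : R[i]) : cmeas (fun _ : T => c).
Proof. by split; exact: measurable_cst. Qed.

Lemma cmeas_expi (f : T -> R) : measurable_fun [set: T] f -> cmeas (fun x => expi (f x)).
Proof.
move=> mf; split.
  by apply: (measurableT_comp _ mf); apply: continuous_measurable_fun; exact: continuous_cos.
by apply: (measurableT_comp _ mf); apply: continuous_measurable_fun; exact: continuous_sin.
Qed.

Lemma cmeas_comp d' (T' : measurableType d') (h : T' -> T) f :
  measurable_fun [set: T'] h -> cmeas f -> cmeas (f \o h).
Proof. by move=> mh [f1 f2]; split; [exact: (measurableT_comp f1)|exact: (measurableT_comp f2)]. Qed.

Lemma measurable_cabs f : cmeas f -> measurable_fun [set: T] (fun x => cabs (f x)).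
Proof.
move=> [f1 f2].
have ms : measurable_fun [set: R] (@Num.sqrt R).
  by apply: continuous_measurable_fun; exact: sqrt_continuous.
apply: (measurableT_comp ms).
by apply: measurable_funD; exact: measurable_funX.
Qed.

End complex_numbers.

(** * Fourier transforms *)

Section fourier_transform.
Context {R : realType} {n : nat}.
Local Open Scope complex_scope.
Implicit Types (x y v xi : 'rV[R]_n) (f g u : 'rV[R]_n -> R[i]) (p q : 'rV[R]_n -> R).

(** Coordinatewise, so that only preimages of Borel sets are involved and [x - y] qualifies on the
    product space; measurability into [Leb R n] would concern all Carathéodory sets. *)
Definition vmeas {d} {T : measurableType d} (h : T -> 'rV[R]_n) :=
  forall i, measurable_fun [set: T] (fun z => h z 0 i).

Section measurability.
Context {d} {T : measurableType d}.
Implicit Types h k : T -> 'rV[R]_n.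

Lemma vmeas_cst v : vmeas (fun _ : T => v).
Proof. by move=> i; exact: measurable_cst. Qed.

Lemma vmeasD h k : vmeas h -> vmeas k -> vmeas (fun z => h z + k z).
Proof. by move=> mh mk i; under eq_fun do rewrite mxE; exact: measurable_funD. Qed.

Lemma vmeasZ (l : R) h : vmeas h -> vmeas (fun z => l *: h z).
Proof.
move=> mh i; under eq_fun do rewrite mxE.
by apply: measurable_funM => //; exact: measurable_cst.
Qed.

Lemma vmeasB h k : vmeas h -> vmeas k -> vmeas (fun z => h z - k z).
Proof.
move=> mh mk; apply: vmeasD => //; under eq_fun do rewrite -scaleN1r.
exact: vmeasZ.
Qed.

Lemma measurable_dotv h k : vmeas h -> vmeas k ->
  measurable_fun [set: T] (fun z => dotv (h z) (k z)).
Proof.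
move=> mh mk; rewrite /dotv.
by apply: (measurable_sum _ (h := fun i z => h z 0 i * k z 0 i)) => i; apply: measurable_funM.
Qed.

Lemma measurable_gauss h : vmeas h -> measurable_fun [set: T] (fun z => gauss (h z)).
Proof.
move=> mh; have mE : measurable_fun [set: R] (fun t : R => expR (- (2^-1 * t))).
  have m1 : measurable_fun [set: R] (fun t : R => - (2^-1 * t)).
    under eq_fun do rewrite -mulNr.
    by apply: measurable_funM => //; exact: measurable_cst.
  exact: (measurableT_comp (@measurable_expR R) m1).
exact: (measurableT_comp mE (measurable_dotv mh mh)).
Qed.

End measurability.

Lemma vmeas_id : vmeas (fun z : Leb R n => z : 'rV[R]_n).
Proof. by move=> i; exact: measurable_coord. Qed.

Lemma vmeas_fst : vmeas (fun z : Leb R n * Leb R n => z.1 : 'rV[R]_n).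
Proof. by move=> i; exact: (measurableT_comp (measurable_coord i) measurable_fst). Qed.

Lemma vmeas_snd : vmeas (fun z : Leb R n * Leb R n => z.2 : 'rV[R]_n).
Proof. by move=> i; exact: (measurableT_comp (measurable_coord i) measurable_snd). Qed.

Definition cintegrable f :=
  Lintegrable (fun x => cre (f x)) /\ Lintegrable (fun x => cim (f x)).

Lemma cintegrable_cmeas f : cintegrable f -> cmeas (f : Leb R n -> R[i]).
Proof. by move=> [f1 f2]; split; exact: Lintegrable_meas. Qed.

Lemma cintegrable_le f p : cmeas (f : Leb R n -> R[i]) -> Lintegrable p ->
  (forall x, cabs (f x) <= p x) -> cintegrable f.
Proof.
move=> [f1 f2] ip fp; split; apply: (Lintegrable_le _ ip) => // x.
  exact: le_trans (normr_cre_le _) (fp x).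
exact: le_trans (normr_cim_le _) (fp x).
Qed.

Lemma Lintegrable_norm p : Lintegrable p -> Lintegrable (fun x => `|p x|).
Proof. by move=> ip; exact: (integrable_abse ip). Qed.

Lemma Lintegrable_cabs f : cintegrable f -> Lintegrable (fun x => cabs (f x)).
Proof.
move=> fi; have [f1 f2] := fi.
apply: (Lintegrable_le (g := fun x => `|cre (f x)| + `|cim (f x)|)).
- exact: (measurable_cabs (cintegrable_cmeas fi)).
- by apply: LintegrableD; exact: Lintegrable_norm.
- by move=> x; rewrite (ger0_norm (cabs_ge0 _)) cabs_le.
Qed.

Lemma cintegrable_mull f g : cintegrable f -> cmeas (g : Leb R n -> R[i]) ->
  (forall x, cabs (g x) <= 1) -> cintegrable (fun x => f x * g x).
Proof.
move=> fi mg g1; apply: (cintegrable_le _ (Lintegrable_cabs fi)).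
  exact: (cmeasM (cintegrable_cmeas fi) mg).
by move=> x; rewrite cabsM ler_piMr// cabs_ge0.
Qed.

Lemma cintegrableZ f (c : R[i]) : cintegrable f -> cintegrable (fun x => c * f x).
Proof.
move=> fi; apply: (cintegrable_le _ (LintegrableZ (cabs c) (Lintegrable_cabs fi))).
  by apply: cmeasM; [exact: cmeas_cst|exact: cintegrable_cmeas].
by move=> x; rewrite cabsM.
Qed.

Lemma cintZ f (c : R[i]) : cintegrable f -> cint (fun x => c * f x) = c * cint f.
Proof.
move=> [f1 f2]; rewrite [RHS]cpair_eq cre_mul cim_mul /cint /=.
congr (_ +i* _).
  rewrite -[LHS]/(Lint (fun x => cre (c * f x))).
  under [X in Lint X]eq_fun do rewrite cre_mul -mulNr.
  by rewrite LintD ?LintZ ?mulNr//; exact: LintegrableZ.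
rewrite -[LHS]/(Lint (fun x => cim (c * f x))).
under [X in Lint X]eq_fun do rewrite cim_mul.
by rewrite LintD ?LintZ//; exact: LintegrableZ.
Qed.

Lemma cint_real p : cint (fun x => (p x)%:C) = (Lint p)%:C.
Proof.
by rewrite /cint; congr (_ +i* _); rewrite /= -[LHS]/(Lint (fun=> 0)) /Lint /Rintegral integral0.
Qed.

Lemma cint_shift f v : cintegrable f -> cint (fun x => f (x + v)) = cint f.
Proof.
move=> [f1 f2]; have E p : Lintegrable p -> Lint (fun x => p (x + v)) = Lint p.
  move=> ip; transitivity (Lint (p \o affine 1 v)).
    by congr Lint; apply/funext => x; rewrite /affine /= scale1r.
  by rewrite Lint_affine// expr1n invr1 mul1r.
by rewrite /cint; congr (_ +i* _); [exact: (E _ f1)|exact: (E _ f2)].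
Qed.

Section fubini.
Variables (F : 'rV[R]_n -> 'rV[R]_n -> R[i]) (p q : 'rV[R]_n -> R).
Hypothesis mF : cmeas (fun z : Leb R n * Leb R n => F z.1 z.2).
Hypotheses (p0 : forall x, 0 <= p x) (q0 : forall x, 0 <= q x).
Hypotheses (ip : Lintegrable p) (iq : Lintegrable q).
Hypothesis Fpq : forall x y, cabs (F x y) <= p x * q y.

Let Fre x y : `|cre (F x y)| <= p x * q y.
Proof. exact: le_trans (normr_cre_le _) (Fpq x y). Qed.

Let Fim x y : `|cim (F x y)| <= p x * q y.
Proof. exact: le_trans (normr_cim_le _) (Fpq x y). Qed.

Lemma cint_fubini :
  cint (fun x => cint (F x)) = cint (fun y => cint (fun x => F x y)).
Proof.
have H1 := @Rintegral_fubini _ _ _ _ R (lebesgue_sf (R := R) (n := n))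
  (lebesgue_sf (R := R) (n := n)) _ p q mF.1 p0 q0 ip iq Fre.
have H2 := @Rintegral_fubini _ _ _ _ R (lebesgue_sf (R := R) (n := n))
  (lebesgue_sf (R := R) (n := n)) _ p q mF.2 p0 q0 ip iq Fim.
exact: (congr2 (fun a b => a +i* b) H1 H2).
Qed.

Lemma cintegrable_cint : cintegrable (fun x => cint (F x)).
Proof.
have H1 := @integrable_Rintegral1 _ _ _ _ R (lebesgue_sf (R := R) (n := n))
  (lebesgue_sf (R := R) (n := n)) _ p q mF.1 p0 q0 ip iq Fre.
have H2 := @integrable_Rintegral1 _ _ _ _ R (lebesgue_sf (R := R) (n := n))
  (lebesgue_sf (R := R) (n := n)) _ p q mF.2 p0 q0 ip iq Fim.
by split; [exact: H1|exact: H2].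
Qed.

End fubini.

(** Fubini for [f x * g xi * expi (- dotv x xi)]. Since [fourierL2] is defined by this identity
    against Schwartz functions, it identifies the L^2 transform of an integrable function with its
    integral. *)
Lemma multiplication_formula f g : cintegrable f -> cintegrable g ->
  cint (fun xi => fourier f xi * g xi) = cint (fun x => f x * fourier g x).
Proof.
move=> fi gi.
have me h k : cmeas (h : Leb R n -> R[i]) -> cmeas (fun x : Leb R n => h x * expi (- dotv (x : 'rV[R]_n) k)).
  move=> mh; apply: (cmeasM mh); apply: cmeas_expi; apply: measurable_funN.
  by apply: measurable_dotv; [exact: vmeas_id|exact: vmeas_cst].
have ie h k : cintegrable h -> cintegrable (fun x => h x * expi (- dotv x k)).
  move=> ih; apply: (cintegrable_le _ (Lintegrable_cabs ih)).
    by apply: me; exact: cintegrable_cmeas.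
  by move=> x; rewrite cabsM cabs_expi mulr1.
pose F xi x := g xi * (f x * expi (- dotv x xi)).
transitivity (cint (fun xi => cint (F xi))).
  congr cint; apply/funext => xi.
  by rewrite mulrC -cintZ//; exact: ie.
rewrite (@cint_fubini F (fun xi => cabs (g xi)) (fun x => cabs (f x))).
- congr cint; apply/funext => x; rewrite -cintZ; last exact: ie.
  by congr cint; apply/funext => xi; rewrite /F mulrCA dotvC.
- apply: cmeasM; first exact: (cmeas_comp measurable_fst (cintegrable_cmeas gi)).
  apply: cmeasM; first exact: (cmeas_comp measurable_snd (cintegrable_cmeas fi)).
  apply: cmeas_expi; apply: measurable_funN.
  by apply: measurable_dotv; [exact: vmeas_snd|exact: vmeas_fst].
- by move=> x; exact: cabs_ge0.
- by move=> x; exact: cabs_ge0.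
- exact: Lintegrable_cabs.
- exact: Lintegrable_cabs.
- by move=> xi x; rewrite !cabsM cabs_expi mulr1.
Qed.

Lemma Lintegrable_gauss (l : R) v : 0 < l ->
  Lintegrable (fun x => gauss (l *: x + v)).
Proof.
move=> l0; apply: (Lintegrable_affine v l0).
have h : (0 : R) < 2^-1 by rewrite invr_gt0.
have := Lintegrable_polyfun_gauss h (@polyfun_cst R n 1).
by congr Lintegrable; apply/funext => x; rewrite mul1r.
Qed.

Lemma Lint_gauss (l : R) v : 0 < l ->
  Lint (fun x => gauss (l *: x + v)) = l ^- n * gauss_mass (R := R) (n := n).
Proof.
move=> l0; rewrite -[LHS]/(Lint (gauss \o affine l v)) Lint_affine//.
have := @Lintegrable_gauss 1 0 ltr01.
by congr Lintegrable; apply/funext => x; rewrite scale1r addr0.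
Qed.

Lemma cintegrable_gauss_expi (l : R) v : 0 < l ->
  cintegrable (fun xi => (gauss (l *: xi))%:C * expi (dotv xi v)).
Proof.
move=> l0; apply: (cintegrable_le (p := fun xi => gauss (l *: xi + 0))).
- apply: cmeasM.
    by apply: cmeas_real; apply: measurable_gauss; apply: vmeasZ; exact: vmeas_id.
  by apply: cmeas_expi; apply: measurable_dotv; [exact: vmeas_id|exact: vmeas_cst].
- exact: Lintegrable_gauss.
- by move=> x; rewrite cabsM cabs_expi mulr1 cabs_real addr0 ger0_norm// expR_ge0.
Qed.

Lemma cint_gauss_expi (l : R) v : 0 < l ->
  cint (fun xi => (gauss (l *: xi))%:C * expi (dotv xi v)) =
  (l ^- n * gauss_mass (R := R) (n := n) * gauss (l^-1 *: v))%:C.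
Proof.
move=> l0; have l0' : l != 0 by rewrite gt_eqF.
pose F (th : R) x := cos (dotv x (l^-1 *: v) + th) * gauss x.
have iF th : Lintegrable (F th).
  have := Lintegrable_gauss_trig 1 th (l^-1 *: v) (@continuous_cos R) (@cos_max R).
  by congr Lintegrable; apply/funext => x; rewrite mul1r.
have FE th x : (F th \o affine l 0) x = cos (dotv x v + th) * gauss (l *: x).
  by rewrite /F /affine /= addr0 dotvZl dotvZr mulrA mulfV// mul1r.
have IF th : Lint (F th \o affine l 0) =
    l ^- n * (cos th * gauss_mass (R := R) (n := n) * gauss (l^-1 *: v)).
  by rewrite Lint_affine// /F Lint_cos_gauss.
rewrite /cint; congr (_ +i* _).
  rewrite -[LHS]/(Lint (fun xi => cre ((gauss (l *: xi))%:C * expi (dotv xi v)))).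
  rewrite -[in RHS]mulrA -[gauss_mass]mul1r -(@cos0 R) -IF; congr Lint.
  by apply/funext => x; rewrite FE cre_mul /= mul0r subr0 addr0 mulrC.
rewrite -[LHS]/(Lint (fun xi => cim ((gauss (l *: xi))%:C * expi (dotv xi v)))).
(* The sine is minus a cosine with phase [pi / 2], for which [Lint_cos_gauss] gives 0. *)
have -> : (fun xi => cim ((gauss (l *: xi))%:C * expi (dotv xi v))) =
   (fun xi => -1 * (F (pi / 2) \o affine l 0) xi).
  apply/funext => x; rewrite FE cim_mul /= mul0r addr0 cosDpihalf mulrC.
  by rewrite mulN1r mulNr opprK.
rewrite LintZ; last exact: Lintegrable_affine.
by rewrite IF cos_pihalf !mul0r !mulr0.
Qed.

(** The Gaussian factor makes the double integral absolutely convergent, so Fubini turns it into a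
    convolution. The value [s = -1] with [l = 1] is used for [mult_op]; [s = 1] with arbitrary [l]
    is used for the energy estimate. *)
Lemma cint_gauss_fourier (l s : R) u x : 0 < l -> cintegrable u ->
  cint (fun xi => (gauss (l *: xi))%:C * cint (fun y => u y * expi (s * dotv y xi)) *
     expi (- (s * dotv x xi))) =
  cint (fun y => u y * (l ^- n * gauss_mass (R := R) (n := n) *
     gauss (l^-1 *: (s *: (y - x))))%:C).
Proof.
move=> l0 ui.
pose c xi : R[i] := (gauss (l *: xi))%:C * expi (- (s * dotv x xi)).
pose F xi y := c xi * (u y * expi (s * dotv y xi)).
have mu := cintegrable_cmeas ui.
have ie xi : cintegrable (fun y => u y * expi (s * dotv y xi)).
  apply: (cintegrable_mull ui); last by move=> y; rewrite cabs_expi.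
  apply: cmeas_expi; apply: measurable_funM; first exact: measurable_cst.
  by apply: measurable_dotv; [exact: vmeas_id|exact: vmeas_cst].
transitivity (cint (fun xi => cint (F xi))).
  by congr cint; apply/funext => xi; rewrite cintZ// /c mulrAC.
rewrite (@cint_fubini F (fun xi => gauss (l *: xi + 0)) (fun y => cabs (u y))).
- congr cint; apply/funext => y; rewrite -cint_gauss_expi// -cintZ; last first.
    exact: cintegrable_gauss_expi.
  congr cint; apply/funext => xi; rewrite /F /c mulrCA -!mulrA; congr (_ * (_ * _)).
  rewrite -expiD; congr expi; rewrite dotvZr [dotv xi _]dotvC dotvDl dotvNl; ring.
- apply: cmeasM.
    apply: cmeasM.
      by apply: cmeas_real; apply: measurable_gauss; apply: vmeasZ; exact: vmeas_fst.
    apply: cmeas_expi; apply: measurable_funN; apply: measurable_funM; first exact: measurable_cst.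
    by apply: measurable_dotv; [exact: vmeas_cst|exact: vmeas_fst].
  apply: cmeasM; first exact: (cmeas_comp measurable_snd mu).
  apply: cmeas_expi; apply: measurable_funM; first exact: measurable_cst.
  by apply: measurable_dotv; [exact: vmeas_snd|exact: vmeas_fst].
- by move=> xi; exact: expR_ge0.
- by move=> y; exact: cabs_ge0.
- exact: Lintegrable_gauss.
- exact: Lintegrable_cabs.
- move=> xi y; rewrite /F /c !cabsM !cabs_expi !mulr1 cabs_real addr0.
  by rewrite ger0_norm// expR_ge0.
Qed.

End fourier_transform.

(** * Boundedness on Schwartz functions *)

Section weighted_sup_norm.
Context {R : realType} {n : nat}.
Local Open Scope complex_scope.
Implicit Types (x y v : 'rV[R]_n) (u f : 'rV[R]_n -> R[i]) (w : 'rV[R]_n -> R).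

Lemma rschwartz_integrable (g : 'rV[R]_n -> R) : rschwartz g -> Lintegrable g.
Proof.
move=> /(_ [::])[/= cg [_ dg]].
have [C HC] := dg (fun=> 0%N).
have H i : exists D, forall x : 'rV[R]_n, `|g x| * `|x 0 i| ^+ n.+1 <= D.
  have [D HD] := dg (fun j => if j == i then n.+1 else 0%N).
  exists D => x; have := HD x; rewrite (bigD1 i)//= eqxx big1 ?mulr1; last first.
    by move=> j /negbTE ->; rewrite expr0.
  by rewrite normrM normrX mulrC.
pose D i := sval (cid (H i)).
have HD i x : `|g x| * `|x 0 i| ^+ n.+1 <= D i by exact: svalP (cid (H i)) x.
have D0 i : 0 <= D i by apply: le_trans (HD i 0); rewrite mulr_ge0// exprn_ge0.
have gC x : `|g x| <= C by have := HC x; rewrite big1 ?mul1r// => i _; rewrite expr0.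
have C0 : 0 <= C by exact: le_trans (gC 0).
apply: (@Lintegrable_decay _ _ _ (C + \sum_i D i)).
- exact: continuous_Lmeas.
- by move=> x; rewrite (le_trans (gC x))// lerDl sumr_ge0.
- move=> x i; rewrite (le_trans (HD i x))// (bigD1 i)//= addrCA lerDl.
  by rewrite addr_ge0// sumr_ge0.
Qed.

Lemma schwartz_cintegrable u : schwartz u -> cintegrable u.
Proof. by move=> [u1 u2]; split; exact: rschwartz_integrable. Qed.

Lemma continuous_cabs u : continuous (fun x => cre (u x)) ->
  continuous (fun x => cim (u x)) -> continuous (fun x => cabs (u x)).
Proof.
move=> c1 c2 x.
apply: (@continuous_comp _ _ _ (fun x => cre (u x) ^+ 2 + cim (u x) ^+ 2) (@Num.sqrt R)).
  apply: (@continuousD R _ _ (fun x => cre (u x) ^+ 2) (fun x => cim (u x) ^+ 2) x).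
    exact: (continuous_mul c1 c1).
  exact: (continuous_mul c2 c2).
exact: sqrt_continuous.
Qed.

Lemma normr_Lint_le (g p : 'rV[R]_n -> R) : Lintegrable g -> Lintegrable p ->
  (forall x, `|g x| <= p x) -> `|Lint g| <= Lint p.
Proof.
move=> ig ip gp; apply: (le_trans (le_normr_Rintegral measurableT ig)).
by apply: le_Rintegral => //; exact: (Lintegrable_norm ig).
Qed.

(** The factor 2 comes from estimating real and imaginary parts separately. *)
Lemma cabs_cint_le u (p : 'rV[R]_n -> R) : cmeas (u : Leb R n -> R[i]) ->
  Lintegrable p -> (forall x, cabs (u x) <= p x) -> cabs (cint u) <= 2 * Lint p.
Proof.
move=> mu ip up; have [i1 i2] := cintegrable_le mu ip up.
rewrite (le_trans (cabs_le _))// mulr2n mulrDl mul1r lerD//.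
  by apply: normr_Lint_le => // x; exact: le_trans (normr_cre_le _) (up x).
by apply: normr_Lint_le => // x; exact: le_trans (normr_cim_le _) (up x).
Qed.

Lemma lebesgue_le (A B : set 'rV[R]_n) : A `<=` B ->
  (lebesgue R n A <= lebesgue R n B)%E.
Proof. exact: le_leb_outer. Qed.

Hypothesis cube_gt0 : (0 < lebesgue R n (cube 0 1))%E.

Lemma lebesgue_cube_gt0 v (l : R) : 0 < l -> (0 < lebesgue R n (cube v l))%E.
Proof. by move=> l0; rewrite lebesgue_cube// mule_gt0// lte_fin exprn_gt0. Qed.

Lemma lebesgue_open_gt0 (O : set 'rV[R]_n) x : open O -> O x ->
  (0 < lebesgue R n O)%E.
Proof.
move=> oO Ox.
have /nbhs_ballP[e /= e0 xeO] : nbhs x O by exact: open_nbhs_nbhs.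
apply: lt_le_trans (lebesgue_cube_gt0 x (e0 : 0 < e)) (lebesgue_le _) => y yx.
apply: xeO; split => // i j; rewrite ord1 /ball/=.
by have := yx j; rewrite mxE => /andP[? ?]; rewrite ltr_norml; apply/andP; split; lra.
Qed.

Lemma wnorm_le u w (c : R) : (forall x, cabs (u x) * w x <= c) ->
  (wnorm w u <= c%:E)%E.
Proof. by move=> uc; apply/ess_supP; apply: aeW => x; rewrite lee_fin. Qed.

Lemma wnorm_ge u w (c : R) (A : set 'rV[R]_n) : (0 < lebesgue R n A)%E ->
  (forall x, A x -> c <= cabs (u x) * w x) -> (c%:E <= wnorm w u)%E.
Proof.
move=> A0 uc; rewrite leNgt; apply/negP => uc'.
(* The norm is an extended real which is not yet known to be nonnegative, so the value [-oo] is
   treated too. *)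
have [r ur rc] : exists2 r : R, (wnorm w u <= r%:E)%E & r < c.
  case: (wnorm w u) uc' => [r|//|]; first by rewrite lte_fin => rc; exists r.
  by move=> _; exists (c - 1); [exact: leNye|rewrite ltrBlDr ltrDl].
have /ess_supP[N [mN N0 uN]] := ur.
move: A0; rewrite ltNge => /negP; apply; rewrite -N0; apply: lebesgue_le => x Ax.
by apply: uN => /=; rewrite lee_fin => /le_lt_trans/(_ rc); rewrite ltNge uc.
Qed.

(** That is, the set where [w = 1] has dense interior. Openness of [V] is essential: it gives [V]
    positive measure, which is what an essential supremum detects. *)
Definition dense_unit w := forall (O : set 'rV[R]_n) x, open O -> O x ->
  exists V y, [/\ open V, V y, V `<=` O & forall z, V z -> w z = 1].

(** If [|u|] exceeded [c] at a point, it would exceed some [r > c] on an open set, hence on an open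
    set of positive measure where [w = 1]. *)
Lemma sup_le_wnorm u w (c : R) : dense_unit w ->
  continuous (fun x => cabs (u x)) -> (wnorm w u <= c%:E)%E ->
  forall x, cabs (u x) <= c.
Proof.
move=> dw cu uc x; rewrite leNgt; apply/negP => xc.
pose r := (c + cabs (u x)) / 2.
have rx : r < cabs (u x) by rewrite /r; lra.
have cr : c < r by rewrite /r; lra.
have oO : open ((fun x => cabs (u x)) @^-1` [set t | r < t]).
  by move/continuousP : cu; apply; exact: open_gt.
have [V [y [oV Vy VO w1]]] := dw _ x oO rx.
have : (r%:E <= wnorm w u)%E.
  apply: (wnorm_ge (lebesgue_open_gt0 oV Vy)) => z Vz.
  by rewrite w1// mulr1 ltW//; exact: VO.
by move=> /le_trans /(_ uc); rewrite lee_fin leNgt cr.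
Qed.

Definition gaussC x : R[i] := (gauss x)%:C.

Lemma schwartz_gaussC : schwartz gaussC.
Proof.
split; first exact: rschwartz_gauss.
have D0 (l : seq 'I_n) : dpart l (fun x => cim (gaussC x)) = fun=> 0.
  elim: l => //= i l ->; apply/funext => x; exact: derive_cst.
move=> l; rewrite D0; split; [exact: cst_continuous|split].
- by move=> i x; exact: derivable_cst.
- by move=> alpha; exists 0 => x; rewrite mulr0 normr0.
Qed.

(** The operator is convolution with a Gaussian. The true constant is [(2 pi)^(-n/2)], but its two
    factors are left as they stand. *)
Lemma mult_op_gaussC u x : cintegrable u ->
  mult_op gaussC u x = ((2 * pi) ^- n)%:C *
    cint (fun y => u y * (gauss_mass (R := R) (n := n) * gauss (y - x))%:C).
Proof.
move=> ui; rewrite /mult_op /ifourier; congr (_ * _).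
transitivity (cint (fun xi => (gauss (1 *: xi))%:C *
    cint (fun y => u y * expi (-1 * dotv y xi)) * expi (- (-1 * dotv x xi)))).
  congr cint; apply/funext => xi; rewrite scale1r mulN1r opprK.
  by congr (_ * _ * _); congr cint; apply/funext => y; rewrite mulN1r.
rewrite (cint_gauss_fourier (-1) x ltr01 ui); congr cint; apply/funext => y.
rewrite expr1n invr1 mul1r scale1r scaleN1r; congr (_ * (_ * _)%:C).
by rewrite /gauss dotvNl dotvC dotvNl opprK.
Qed.

Lemma gauss_mass_ge0 : 0 <= gauss_mass (R := R) (n := n).
Proof. by apply: Rintegral_ge0 => x _; exact: expR_ge0. Qed.

Lemma multiplier_S_gaussC w : dense_unit w -> (forall x, 0 <= w x <= 1) ->
  multiplier_S w gaussC.
Proof.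
move=> dw w01.
pose g := gauss_mass (R := R) (n := n).
have g0 : 0 <= g by exact: gauss_mass_ge0.
have p0 : 0 <= (2 * pi) ^- n :> R by rewrite invr_ge0 exprn_ge0// mulr_ge0// pi_ge0.
(* One [g] is the factor of the kernel, the other is the integral of [gauss], and the 2 is that of
   [cabs_cint_le]. *)
exists ((2 * pi) ^- n * (2 * (g * g))) => u su [_ uoo].
have ui := schwartz_cintegrable su.
have cu : continuous (fun x => cabs (u x)).
  by apply: continuous_cabs; [exact: (su.1 [::]).1|exact: (su.2 [::]).1].
(* The value [-oo] is excluded because [sup_le_wnorm] would then give [|u| <= -1]. *)
have [c uc] : exists c : R, wnorm w u = c%:E.
  case E: (wnorm w u) => [c||]; first by exists c.
    by move: uoo; rewrite E.
  have := @sup_le_wnorm u w (-1) dw cu; rewrite E leNye => /(_ isT 0).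
  by rewrite leNgt (lt_le_trans _ (cabs_ge0 _))// ltrN10.
have ubound : forall x, cabs (u x) <= c.
  by apply: (sup_le_wnorm dw cu); rewrite uc.
have c0 : 0 <= c by exact: le_trans (cabs_ge0 _) (ubound 0).
rewrite uc -EFinM; apply: wnorm_le => x; have /andP[w0 w1] := w01 x.
rewrite (le_trans (ler_piMr (cabs_ge0 _) w1))//.
rewrite mult_op_gaussC// cabsM cabs_real ger0_norm// -[leRHS]mulrA ler_wpM2l//.
have ig : Lintegrable (fun y => gauss (1 *: y - x)) by exact: Lintegrable_gauss.
have -> : 2 * (g * g) * c = 2 * Lint (fun y => c * g * gauss (1 *: y - x)).
  by rewrite LintZ// Lint_gauss// expr1n invr1 mul1r /g; ring.
apply: cabs_cint_le.
- apply: cmeasM; first exact: cintegrable_cmeas.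
  apply: cmeas_real; apply: measurable_funM; first exact: measurable_cst.
  by apply: measurable_gauss; apply: vmeasB; [exact: vmeas_id|exact: vmeas_cst].
- exact: LintegrableZ.
- move=> y; rewrite cabsM cabs_real ger0_norm ?mulr_ge0 ?expR_ge0//.
  by rewrite scale1r mulrA ler_wpM2r ?expR_ge0// ler_wpM2r.
Qed.

End weighted_sup_norm.

(** * The weight *)

Section weight.
Context {R : realType} {n : nat}.
Variable hn : (0 < n)%N.
Variables (G : set 'rV[R]_n) (b : nat -> R).
Hypothesis G01 : forall x : 'rV[R]_n, G x -> forall i : 'I_n, 0 <= x 0 i <= 1.
Hypothesis G_closed : closed G.
Hypothesis G_int : interior G = set0.
Hypothesis b01 : forall m : nat, (0 < m)%N -> 0 < b m < 1.
Implicit Types (x y z : 'rV[R]_n).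

Let i0 := Ordinal hn.

Lemma Gm_coord0 m y : Gm G m y -> (2 * m)%:R <= y 0 i0 <= (2 * m)%:R + 1.
Proof.
by move=> /G01/(_ i0); rewrite !mxE /= => /andP[? ?]; apply/andP; split; lra.
Qed.

Lemma Gm_coord m y i : Gm G m y -> i != i0 -> 0 <= y 0 i <= 1.
Proof.
move=> /G01/(_ i); rewrite !mxE; case: eqP => [i0E|_]; last by rewrite subr0.
by move=> _ /eqP; case; apply/val_inj.
Qed.

(** The first coordinates of distinct translates lie in slabs at distance at least 1. *)
Lemma Gm_close m m' y z : Gm G m y -> Gm G m' z -> `|y 0 i0 - z 0 i0| < 2^-1 -> m = m'.
Proof.
move=> /Gm_coord0/andP[y1 y2] /Gm_coord0/andP[z1 z2]; rewrite ltr_norml => /andP[h1 h2].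
apply/eqP; rewrite eqn_leq; apply/andP; split.
  rewrite leqNgt; apply/negP => mm; have : (2 * m' + 2 <= 2 * m)%N by lia.
  by rewrite -(ler_nat R) natrD; lra.
rewrite leqNgt; apply/negP => mm; have : (2 * m + 2 <= 2 * m')%N by lia.
by rewrite -(ler_nat R) natrD; lra.
Qed.

Lemma Gm_inj m m' y : Gm G m y -> Gm G m' y -> m = m'.
Proof. by move=> h1 h2; apply: (Gm_close h1 h2); rewrite subrr normr0 invr_gt0. Qed.

(** The translates are disjoint, so the index picked by [xget] is forced. *)
Lemma wplus_Gm m y : (0 < m)%N -> Gm G m y -> wplus G b y = b m.
Proof.
move=> m0 my; rewrite /wplus; case: pselect => [h|[]] /=; last by exists m.
congr b; case: xgetP => [k -> [k0 ky]|/(_ m) []//]; exact: (Gm_inj ky my).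
Qed.

Lemma wplus_unit y : (forall m, (0 < m)%N -> ~ Gm G m y) -> wplus G b y = 1.
Proof. by move=> h; rewrite /wplus; case: pselect => [[m [m0 my]]|//]; case: (h m m0). Qed.

Lemma wplus_bound y : 0 <= wplus G b y <= 1.
Proof.
case: (pselect (exists m, (0 < m)%N /\ Gm G m y)) => [[m [m0 my]]|h].
  by rewrite (wplus_Gm m0 my); have /andP[b0 b1] := b01 m0; rewrite !ltW.
by rewrite wplus_unit ?ler01 ?lexx// => m m0 my; apply: h; exists m.
Qed.

Lemma wGb_bound y : 0 <= wGb hn G b y <= 1.
Proof. by rewrite /wGb; case: ifP => _; exact: wplus_bound. Qed.

Lemma wGb_Gm m y : (0 < m)%N -> Gm G m y -> wGb hn G b y = b m.
Proof.
move=> m0 my; have /andP[y0 _] := Gm_coord0 my.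
by rewrite /wGb (le_trans _ y0) ?ler0n// (wplus_Gm m0 my).
Qed.

Lemma wGb_unit y : (forall m, (0 < m)%N -> ~ Gm G m y /\ ~ Gm G m (- y)) ->
  wGb hn G b y = 1.
Proof.
move=> h; rewrite /wGb; case: ifP => _; apply: wplus_unit => m m0.
  by have [] := h m m0.
by have [] := h m m0.
Qed.

Lemma continuous_signed_shift (s : R) (v : 'rV[R]_n) : continuous (fun y => s *: y + v).
Proof.
move=> y; apply: (@continuousD R _ _ (fun y => s *: y) (fun=> v) y).
  exact: (@scaler_continuous R _ s y).
exact: cst_continuous.
Qed.

(** A region thin in the first coordinate meets at most one of the sets [G_m] and [- G_m] with
    [m >= 1]. Removing that closed set leaves an open set, nonempty because [G] has empty
    interior. *)
Lemma dense_unit_wGb : dense_unit (wGb hn G b).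
Proof.
move=> O x oO Ox.
pose W := [set y : 'rV[R]_n | `|y 0 i0 - x 0 i0| < 4^-1].
have oW : open W.
  have c : continuous (fun y : 'rV[R]_n => y 0 i0 - x 0 i0).
    move=> y; apply: (@continuousD R _ _ (fun y : 'rV[R]_n => y 0 i0) (fun=> - x 0 i0) y).
      exact: (@coord_continuous R 1 n 0 i0 y).
    exact: cst_continuous.
  have cn : continuous (fun y : 'rV[R]_n => `|y 0 i0 - x 0 i0|).
    by move=> y; apply: (continuous_comp (c y)); exact: norm_continuous.
  by move/continuousP : cn => /(_ [set t | t < 4^-1] (@open_lt _ _)).
pose Q := O `&` W.
have oQ : open Q by exact: openI.
have Qx : Q x by split => //; rewrite /W /= subrr normr0 invr_gt0.
have Q_close y z : Q y -> Q z -> `|y 0 i0 - z 0 i0| < 2^-1.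
  move=> [_ +] [_]; rewrite /W /= !ltr_norml => /andP[? ?] /andP[? ?].
  by apply/andP; split; lra.
(* The sign [s] treats [G_m] and its reflection together. *)
have [[y [m [s [m0 s1 Qy my]]]]|nbad] := pselect (exists y m (s : R),
    [/\ (0 < m)%N, s = 1 \/ s = -1, Q y & Gm G m (s *: y)]); last first.
  exists Q, x; split => //; first by move=> ? [].
  move=> z Qz; apply: wGb_unit => m m0; split => mz; apply: nbad.
    by exists z, m, 1; rewrite scale1r; split => //; left.
  by exists z, m, (-1); rewrite scaleN1r; split => //; right.
have ss : s * s = 1 by case: s1 => ->; rewrite ?mulrNN mul1r.
pose H := [set z : 'rV[R]_n | Gm G m (s *: z)].
have cH : closed H.
  rewrite (_ : H = (fun z => s *: z + (- shift_vec m)) @^-1` G)//.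
  by move/continuous_closedP : (@continuous_signed_shift s (- shift_vec m)); exact.
have oV : open (Q `&` ~` H) by apply: openI => //; exact: closed_openC.
(* Otherwise the open set [Q] lies in [H], and moving it back by the shift and the sign puts a
   nonempty open set inside [G]. *)
have [z [Qz nHz]] : exists z, Q z /\ ~ H z.
  apply: contrapT => nex.
  have QH z : Q z -> H z by move=> Qz; apply: contrapT => nHz; apply: nex; exists z.
  have := @continuous_signed_shift s (s *: shift_vec m).
  move=> /continuousP /(_ _ oQ) oP.
  have PG : (fun z => s *: z + s *: shift_vec m) @^-1` Q `<=` G.
    move=> z /QH; rewrite /H /Gm /= scalerDr !scalerA ss !scale1r.
    by rewrite addrK.
  have : interior G (s *: y - shift_vec m : 'rV[R]_n).
    apply: (filterS PG); apply: open_nbhs_nbhs; split => //=.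
    by rewrite scalerBr !scalerA ss scale1r subrK.
  by rewrite G_int.
exists (Q `&` ~` H), z; split => //; first by move=> ? [[]].
move=> t [Qt nHt]; apply: wGb_unit => k k0.
have yt := Q_close _ _ Qy Qt.
have /andP[yk _] := Gm_coord0 my.
(* Positive indices put the translates at first coordinate at least 2 and their reflections at most
   -2, so two close points cannot lie one in each family. *)
have m2 : (2 : R) <= (2 * m)%:R by rewrite ler_nat; lia.
have k2 : (2 : R) <= (2 * k)%:R by rewrite ler_nat; lia.
move: yk; rewrite mxE; move: yt; rewrite ltr_norml => /andP[yt1 yt2].
case: s1 => sE; rewrite sE ?mul1r ?mulN1r => yk; split => tk.
- apply: nHt; rewrite /H /= sE scale1r -(Gm_close tk (_ : Gm G m y)) //.
    by move: my; rewrite sE scale1r.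
  by rewrite ltr_norml; apply/andP; split; lra.
- by have /andP[] := Gm_coord0 tk; rewrite mxE; lra.
- by have /andP[] := Gm_coord0 tk; lra.
- apply: nHt; rewrite /H /= sE scaleN1r -(Gm_close tk (_ : Gm G m (- y))) //.
    by move: my; rewrite sE scaleN1r.
  by rewrite !mxE ltr_norml; apply/andP; split; lra.
Qed.

Lemma wGb_between m y : (2 * m)%:R + 1 < y 0 i0 < (2 * m)%:R + 2 -> wGb hn G b y = 1.
Proof.
move=> /andP[y1 y2]; apply: wGb_unit => k k0; split => yk.
  have /andP[k1 k2] := Gm_coord0 yk.
  have [mk|mk] := leqP k m.
    have : (2 * k <= 2 * m)%N by lia.
    by rewrite -(ler_nat R); lra.
  have : (2 * m + 2 <= 2 * k)%N by lia.
  by rewrite -(ler_nat R) natrD; lra.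
have /andP[] := Gm_coord0 yk; rewrite mxE.
have := ler0n R (2 * k); have := ler0n R (2 * m); lra.
Qed.

End weight.

(** * Indicators and their Gaussian smoothings *)

Section approximation_and_indicators.
Context {d} {T : measurableType d} {R : realType} (mu : {measure set T -> \bar R}).

(** Monotone convergence: the uniform bound [K] survives the removal of the regularising factors
    [h k]. *)
Lemma ge0_integral_lty_approx (f : T -> R) (h : nat -> T -> R) (K : R) :
  measurable_fun [set: T] f -> (forall k, measurable_fun [set: T] (h k)) ->
  (forall x, 0 <= f x) -> (forall k x, 0 <= h k x) ->
  (forall x k m, (k <= m)%N -> h k x <= h m x) ->
  (forall x, h k x @[k --> \oo] --> (1 : R)) ->
  (forall k, mu.-integrable [set: T] (EFin \o (fun x => f x * h k x))) ->
  (forall k, \int[mu]_(x in [set: T]) (f x * h k x) <= K) ->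
  (\int[mu]_(x in [set: T]) (f x)%:E < +oo)%E.
Proof.
move=> mf mh f0 h0 hh h1 ifh fhK.
pose g k x : \bar R := (f x * h k x)%:E.
have gf x : limn (g^~ x) = (f x)%:E.
  apply/cvg_lim => //; apply: cvg_EFin; first exact: nearW.
  rewrite -[X in _ --> X]mulr1; apply: cvgM; [exact: cvg_cst|exact: h1].
have -> : (\int[mu]_(x in [set: T]) (f x)%:E = \int[mu]_(x in [set: T]) limn (g^~ x))%E.
  by apply: eq_integral => x _; rewrite gf.
have mg k : measurable_fun [set: T] (g k).
  by apply/measurable_EFinP; exact: measurable_funM.
have g0 k x : [set: T] x -> (0 <= g k x)%E by move=> _; rewrite lee_fin mulr_ge0.
have gg x : [set: T] x -> {homo g^~ x : k m / (k <= m)%N >-> (k <= m)%E}.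
  by move=> _ k m km; rewrite lee_fin ler_wpM2l// hh.
have := @cvg_monotone_convergence _ _ _ mu _ measurableT _ mg g0 gg.
move=> /[dup] /cvg_lim <-//; move=> /cvgP gcvg.
apply: (@le_lt_trans _ _ K%:E); last exact: ltry.
apply: lime_le => //; apply: nearW => k.
rewrite -[leLHS]fineK ?lee_fin; first exact: fhK.
exact: (integrable_fin_num _ (ifh k)).
Qed.

Lemma integrable_indic_real (A : set T) : measurable A -> (mu A < +oo)%E ->
  mu.-integrable [set: T] (EFin \o (\1_A : T -> R)).
Proof.
move=> mA Aoo; apply/integrableP; split; first exact/measurable_EFinP.
under eq_integral do rewrite /= ger0_norm//.
by rewrite integral_indic// setIT.
Qed.

Lemma Rintegral_indic (A : set T) : measurable A ->
  \int[mu]_(x in [set: T]) (\1_A x : R) = fine (mu A).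
Proof. by move=> mA; rewrite /Rintegral integral_indic// setIT. Qed.

Lemma ge0_integral_lty (f : T -> R) :
  mu.-integrable [set: T] (EFin \o f) ->
  (\int[mu]_(x in [set: T]) (f x)%:E < +oo)%E.
Proof. by move=> fi; exact: (integrable_lty measurableT fi). Qed.

End approximation_and_indicators.

Section indicator_fourier.
Context {R : realType} {n : nat}.
Local Open Scope complex_scope.
Implicit Types (x y v xi : 'rV[R]_n) (u f : 'rV[R]_n -> R[i]).

Local Notation gm := (gauss_mass (R := R) (n := n)).

Lemma fourierE u xi : fourier u xi = cint (fun y => u y * expi (-1 * dotv y xi)).
Proof. by congr cint; apply/funext => y; rewrite mulN1r. Qed.

Lemma gauss_neg v : gauss (- v) = gauss v :> R.
Proof. by rewrite /gauss dotvNl dotvC dotvNl opprK. Qed.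

Lemma gauss_ge0 v : 0 <= gauss v :> R.
Proof. exact: expR_ge0. Qed.

(** Fubini gives measurability of an integral in its parameter only under a product majorant; the
    transform is therefore damped by a Gaussian in [xi], and the damping is undone by multiplying
    with its reciprocal. *)
Lemma cmeas_fourier (s : R) u : cintegrable u ->
  cmeas (fun xi : Leb R n => cint (fun y => u y * expi (s * dotv y (xi : 'rV[R]_n)))).
Proof.
move=> ui.
pose F xi y := (gauss (1 *: xi + 0))%:C * (u y * expi (s * dotv y xi)).
have mF : cmeas (fun z : Leb R n * Leb R n => F z.1 z.2).
  apply: cmeasM.
    apply: cmeas_real; apply: measurable_gauss; apply: vmeasD; last exact: vmeas_cst.
    by apply: vmeasZ; exact: vmeas_fst.
  apply: cmeasM; first exact: (cmeas_comp measurable_snd (cintegrable_cmeas ui)).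
  apply: cmeas_expi; apply: measurable_funM; first exact: measurable_cst.
  by apply: measurable_dotv; [exact: vmeas_snd|exact: vmeas_fst].
have iF : cintegrable (fun xi => cint (F xi)).
  apply: (cintegrable_cint mF (p := fun xi => gauss (1 *: xi + 0)) (q := fun y => cabs (u y))).
  - by move=> xi; exact: expR_ge0.
  - by move=> y; exact: cabs_ge0.
  - exact: Lintegrable_gauss.
  - exact: Lintegrable_cabs.
  - by move=> xi y; rewrite !cabsM cabs_expi mulr1 cabs_real ger0_norm// expR_ge0.
have -> : (fun xi : Leb R n => cint (fun y => u y * expi (s * dotv y (xi : 'rV[R]_n)))) =
    (fun xi : Leb R n => (expR (2^-1 * dotv (xi : 'rV[R]_n) (xi : 'rV[R]_n)))%:C * cint (F xi)).
  apply/funext => xi; rewrite cintZ; last first.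
    apply: (cintegrable_mull ui); last by move=> y; rewrite cabs_expi.
    apply: cmeas_expi; apply: measurable_funM; first exact: measurable_cst.
    by apply: measurable_dotv; [exact: vmeas_id|exact: vmeas_cst].
  rewrite mulrA -realCM scale1r addr0 /gauss -expRD subrr expR0.
  by rewrite mul1r.
apply: cmeasM; last exact: cintegrable_cmeas.
apply: cmeas_real; apply: (measurableT_comp (@measurable_expR R)).
apply: measurable_funM; first exact: measurable_cst.
by apply: measurable_dotv; exact: vmeas_id.
Qed.

Lemma L2_of_integrable f : cmeas (f : Leb R n -> R[i]) ->
  Lintegrable (fun x => cabs (f x) ^+ 2) -> L2 f.
Proof. by move=> mf fi; split => //; exact: ge0_integral_lty fi. Qed.

Variables (S : set 'rV[R]_n) (D : R).
Hypothesis mS : measurable (S : set (Leb R n)).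
Hypothesis Soo : (lebesgue R n S < +oo)%E.
Hypothesis SD : forall y, S y -> dotv y y <= D.
Hypothesis gm0 : 0 < gm.

Let ind (y : 'rV[R]_n) : R := \1_S y.
Let u y : R[i] := (ind y)%:C.
Let N := Lint ind.

Let ind_ge0 y : 0 <= ind y. Proof. by rewrite /ind indicE. Qed.
Let ind_le1 y : ind y <= 1. Proof. by rewrite /ind indicE; case: (_ \in _). Qed.

Lemma indic_Lintegrable : Lintegrable ind.
Proof. exact: integrable_indic_real. Qed.

Lemma indic_cintegrable : cintegrable u.
Proof.
apply: (cintegrable_le _ indic_Lintegrable).
  by apply: cmeas_real; exact: (Lintegrable_meas indic_Lintegrable).
by move=> y; rewrite cabs_real ger0_norm.
Qed.

Lemma indic_L2 : L2 u.
Proof.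
apply: L2_of_integrable; first exact: (cintegrable_cmeas indic_cintegrable).
have := indic_Lintegrable; congr Lintegrable; apply/funext => y.
rewrite cabs_real ger0_norm// /ind indicE.
by case: (_ \in _); rewrite ?expr1n ?expr0n.
Qed.

Lemma cabs_indic_fourier_le (s : R) xi :
  cabs (cint (fun y => u y * expi (s * dotv y xi))) <= 2 * N.
Proof.
apply: (cabs_cint_le _ indic_Lintegrable); last first.
  by move=> y; rewrite cabsM cabs_expi mulr1 cabs_real ger0_norm.
apply: cmeasM; first exact: (cintegrable_cmeas indic_cintegrable).
apply: cmeas_expi; apply: measurable_funM; first exact: measurable_cst.
by apply: measurable_dotv; [exact: vmeas_id|exact: vmeas_cst].
Qed.

Lemma Lint_indic_ge0 : 0 <= N.
Proof. by apply: Rintegral_ge0 => y _. Qed.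

(** As [u] is real-valued, the second factor is the conjugate of the first. *)
Lemma sqr_cabs_indic_fourier xi :
  fourier u xi * cint (fun y => u y * expi (1 * dotv y xi)) =
  (cabs (fourier u xi) ^+ 2)%:C.
Proof.
rewrite sqr_cabs fourierE.
set a := cint _; set c := cint _.
have ca : cre c = cre a.
  rewrite -[LHS]/(Lint (fun y => cre (u y * expi (1 * dotv y xi)))).
  rewrite -[RHS]/(Lint (fun y => cre (u y * expi (-1 * dotv y xi)))).
  congr Lint; apply/funext => y.
  by rewrite !cre_mul /= mul1r mulN1r cosN !mul0r.
have ia : cim c = - cim a.
  have iy (s : R) : Lintegrable (fun y => cim (u y * expi (s * dotv y xi))).
    have [] // : cintegrable (fun y => u y * expi (s * dotv y xi)).
    apply: (cintegrable_mull indic_cintegrable); last by move=> y; rewrite cabs_expi.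
    apply: cmeas_expi; apply: measurable_funM; first exact: measurable_cst.
    by apply: measurable_dotv; [exact: vmeas_id|exact: vmeas_cst].
  rewrite -[LHS]/(Lint (fun y => cim (u y * expi (1 * dotv y xi)))).
  rewrite -[cim a]/(Lint (fun y => cim (u y * expi (-1 * dotv y xi)))).
  transitivity (-1 * Lint (fun y => cim (u y * expi (-1 * dotv y xi)))); last by rewrite mulN1r.
  rewrite -(LintZ _ (iy (-1))); congr Lint; apply/funext => y.
  by rewrite !cim_mul /= !(mul1r, mulN1r) sinN cosN; ring.
rewrite [LHS]cpair_eq cre_mul cim_mul ca ia; congr (_ +i* _); ring.
Qed.

(* Bessel's inequality up to the constant: the Gaussian-weighted energy of the
   Fourier transform is the energy of [u] smoothed by a Gaussian of total mass
   [gm ^+ 2], whatever the width [l]. *)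
Lemma gauss_energy_indic_fourier (l : R) : 0 < l ->
  Lintegrable (fun xi => cabs (fourier u xi) ^+ 2 * gauss (l *: xi)) /\
  Lint (fun xi => cabs (fourier u xi) ^+ 2 * gauss (l *: xi)) <= gm ^+ 2 * N.
Proof.
move=> l0; have ui := indic_cintegrable.
pose uc xi := cint (fun y => u y * expi (1 * dotv y xi)).
have mu := cmeas_fourier 1 ui.
have mfu : cmeas (fourier u : Leb R n -> R[i]).
  have := cmeas_fourier (-1) ui.
  by congr cmeas; apply/funext => xi; rewrite fourierE.
have mg : measurable_fun [set: Leb R n] (fun xi : Leb R n => gauss (l *: (xi : 'rV[R]_n))).
  by apply: measurable_gauss; apply: vmeasZ; exact: vmeas_id.
have igl : Lintegrable (fun xi => gauss (l *: xi)).
  have := Lintegrable_gauss (0 : 'rV[R]_n) l0.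
  by congr Lintegrable; apply/funext => xi; rewrite addr0.
(* Paired with [fourier u], this gives the energy density; its own transform [psi] is a Gaussian
   average of the indicator. The multiplication formula equates the two sides. *)
pose phi xi := uc xi * (gauss (l *: xi))%:C.
have iphi : cintegrable phi.
  apply: (cintegrable_le _ (LintegrableZ (2 * N) igl)).
    exact: (cmeasM mu (cmeas_real mg)).
  move=> xi; rewrite cabsM cabs_real ger0_norm ?expR_ge0//.
  by rewrite ler_wpM2r ?expR_ge0// cabs_indic_fourier_le.
have iE : Lintegrable (fun xi => cabs (fourier u xi) ^+ 2 * gauss (l *: xi)).
  apply: (Lintegrable_le _ (LintegrableZ ((2 * N) ^+ 2) igl)).
    by apply: measurable_funM mg; apply: measurable_funX; exact: measurable_cabs.
  move=> xi; rewrite normrM !ger0_norm ?expR_ge0 ?exprn_ge0 ?cabs_ge0//.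
  rewrite ler_wpM2r ?expR_ge0// lerXn2r ?nnegrE ?cabs_ge0 ?mulr_ge0 ?Lint_indic_ge0//.
  by rewrite fourierE cabs_indic_fourier_le.
split => //.
pose psi x := Lint (fun y => ind y * (l ^- n * gm * gauss (l^-1 *: y + - (l^-1 *: x)))).
have psiE x : fourier phi x = (psi x)%:C.
  transitivity (cint (fun xi => (gauss (l *: xi))%:C * uc xi * expi (- (1 * dotv x xi)))).
    by congr cint; apply/funext => xi; rewrite /phi mul1r dotvC [uc xi * _]mulrC.
  rewrite (cint_gauss_fourier 1 x l0 ui) -cint_real; congr cint; apply/funext => y.
  by rewrite scale1r scalerBr -realCM.
have c0 : 0 <= l ^- n * gm by rewrite mulr_ge0 ?invr_ge0 ?exprn_ge0// ltW.
have psi0 x : 0 <= psi x.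
  by apply: Rintegral_ge0 => y _; rewrite mulr_ge0// mulr_ge0// gauss_ge0.
have psi_le x : psi x <= gm ^+ 2.
  rewrite -[leLHS](ger0_norm (psi0 x)).
  have l0' : 0 < l^-1 by rewrite invr_gt0.
  have -> : gm ^+ 2 = Lint (fun y => l ^- n * gm * gauss (l^-1 *: y + - (l^-1 *: x))).
    rewrite LintZ; last exact: Lintegrable_gauss.
    by rewrite Lint_gauss// exprVn invrK mulrACA mulVf ?mul1r// expf_neq0// gt_eqF.
  have iG := LintegrableZ (l ^- n * gm) (Lintegrable_gauss (- (l^-1 *: x)) l0').
  have yle y : `|ind y * (l ^- n * gm * gauss (l^-1 *: y + - (l^-1 *: x)))| <=
      l ^- n * gm * gauss (l^-1 *: y + - (l^-1 *: x)).
    have p0 : 0 <= l ^- n * gm * gauss (l^-1 *: y + - (l^-1 *: x)).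
      by rewrite mulr_ge0// gauss_ge0.
    by rewrite ger0_norm; [exact: ler_piMl|exact: mulr_ge0].
  apply: (normr_Lint_le _ iG yle); apply: (Lintegrable_le _ iG yle).
  apply: measurable_funM; first exact: (Lintegrable_meas indic_Lintegrable).
  exact: (Lintegrable_meas iG).
have mpsi : Lmeas psi.
  have [+ _] := cmeas_fourier (-1) iphi.
  by congr measurable_fun; apply/funext => x; rewrite -fourierE psiE.
have EE : (Lint (fun xi => cabs (fourier u xi) ^+ 2 * gauss (l *: xi)))%:C =
   (Lint (fun x => ind x * psi x))%:C :> R[i].
  rewrite -!cint_real; transitivity (cint (fun xi => fourier u xi * phi xi)).
    by congr cint; apply/funext => xi; rewrite /phi mulrA sqr_cabs_indic_fourier realCM.
  rewrite (multiplication_formula ui iphi); congr cint; apply/funext => x.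
  by rewrite psiE realCM.
have -> : Lint (fun xi => cabs (fourier u xi) ^+ 2 * gauss (l *: xi)) =
  Lint (fun x => ind x * psi x) by case: EE.
rewrite -LintZ; last exact: indic_Lintegrable.
have iI := LintegrableZ (gm ^+ 2) indic_Lintegrable.
have xle x : `|ind x * psi x| <= gm ^+ 2 * ind x.
  by rewrite ger0_norm; [rewrite mulrC; exact: ler_wpM2r|exact: mulr_ge0].
apply: le_trans (ler_norm _) _; apply: (normr_Lint_le _ iI xle).
apply: (Lintegrable_le _ iI xle).
by apply: measurable_funM mpsi; exact: (Lintegrable_meas indic_Lintegrable).
Qed.

Lemma indic_fourier_L2 : L2 (fourier u).
Proof.
have mfu : cmeas (fourier u : Leb R n -> R[i]).
  have := cmeas_fourier (-1) indic_cintegrable.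
  by congr cmeas; apply/funext => xi; rewrite fourierE.
split => //.
(* Dilations decreasing to 0 make the Gaussian factors increase to 1. *)
have l0 k : 0 < @harmonic R k by rewrite invr_gt0 ltr0n.
pose h k (xi : Leb R n) : R := gauss (harmonic k *: (xi : 'rV[R]_n)).
apply: (@ge0_integral_lty_approx _ _ _ (lebesgue R n) _ h (gm ^+ 2 * N)).
- by apply: measurable_funX; exact: measurable_cabs.
- by move=> k; apply: measurable_gauss; apply: vmeasZ; exact: vmeas_id.
- by move=> xi; rewrite exprn_ge0// cabs_ge0.
- by move=> k xi; exact: expR_ge0.
- move=> xi k m km; rewrite /h /gauss ler_expR lerN2 ler_pM2l ?invr_gt0//.
  rewrite !dotvZl !dotvZr !mulrA -!expr2 ler_wpM2r ?dotv_ge0//.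
  rewrite lerXn2r ?nnegrE ?(ltW (l0 _))// /harmonic/= lef_pV2 ?posrE ?ltr0n//.
  by rewrite ler_nat ltnS.
- move=> xi; rewrite /h /gauss.
  have -> : (fun k => expR (- (2^-1 * dotv (harmonic k *: xi) (harmonic k *: xi)))) =
     (fun k => expR (- (2^-1 * dotv xi xi) * (@harmonic R k * @harmonic R k))).
    by apply/funext => k; rewrite dotvZl dotvZr; congr expR; ring.
  have H : (fun k => - (2^-1 * dotv xi xi) * (@harmonic R k * @harmonic R k)) @ \oo --> (0 : R).
    rewrite -(mulr0 (- (2^-1 * dotv xi xi))); apply: cvgM; first exact: cvg_cst.
    by rewrite -[X in _ --> X](mulr0 (0 : R)); apply: cvgM; exact: cvg_harmonic.
  have c0 : expR t @[t --> (0 : R)] --> (1 : R).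
    by rewrite -(@expR0 R); exact: continuous_expR.
  have HH := cvg_comp _ _ H c0.
  exact: HH.
- by move=> k; exact: (gauss_energy_indic_fourier (l0 k)).1.
- by move=> k; exact: (gauss_energy_indic_fourier (l0 k)).2.
Qed.

(** From [gauss_shift_le] with [|y|^2 <= D] on [S]: this is what turns the convolution kernel into a
    product majorant [decay x * ind y]. *)
Let B := expR (2^-1 * D).
Let F x y : R[i] := (gauss (x - y))%:C * u y.
Let decay (x : 'rV[R]_n) : R := B * expR (- (4^-1 * dotv x x)).

(** The Gaussian has transform [gm] times itself, so dividing by [gm] makes the multiplier exactly
    [gaussC]. *)
Let v x : R[i] := (gm^-1)%:C * cint (F x).

Let F_le x y : cabs (F x y) <= decay x * ind y.
Proof.
rewrite cabsM !cabs_real !ger0_norm ?expR_ge0// /ind indicE.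
have [yS|_] := boolP (y \in S); last by rewrite !mulr0.
rewrite !mulr1 addrC (le_trans (gauss_shift_le _ _))// ler_wpM2r ?expR_ge0//.
by rewrite ler_expR ler_pM2l ?invr_gt0// dotvNl dotvC dotvNl opprK SD//; exact/set_mem.
Qed.

Let decay_ge0 x : 0 <= decay x.
Proof. by rewrite mulr_ge0// expR_ge0. Qed.

Let decay_int : Lintegrable decay.
Proof.
have h : (0 : R) < 4^-1 by rewrite invr_gt0.
exact: (Lintegrable_polyfun_gauss h (@polyfun_cst R n B)).
Qed.

Let mF : cmeas (fun z : Leb R n * Leb R n => F z.1 z.2).
Proof.
apply: cmeasM; last exact: (cmeas_comp measurable_snd (cintegrable_cmeas indic_cintegrable)).
apply: cmeas_real; apply: measurable_gauss.
by apply: vmeasB; [exact: vmeas_fst|exact: vmeas_snd].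
Qed.

Let cintF : cintegrable (fun x => cint (F x)).
Proof.
exact: (cintegrable_cint mF decay_ge0 ind_ge0 decay_int indic_Lintegrable F_le).
Qed.

Lemma gauss_conv_cintegrable : cintegrable v.
Proof. exact: cintegrableZ. Qed.

Let mF1 x : cmeas (F x : Leb R n -> R[i]).
Proof.
apply: cmeasM; last exact: (cintegrable_cmeas indic_cintegrable).
apply: cmeas_real; apply: measurable_gauss.
by apply: vmeasB; [exact: vmeas_cst|exact: vmeas_id].
Qed.

Lemma gauss_conv_L2 : L2 v.
Proof.
have mv := cintegrable_cmeas gauss_conv_cintegrable.
pose c := gm^-1 * (2 * (B * N)).
have c0 : 0 <= c by rewrite /c !mulr_ge0 ?Lint_indic_ge0 ?expR_ge0// invr_ge0 ltW.
have vE x : cabs (v x) <= c * expR (- (4^-1 * dotv x x)).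
  rewrite /v cabsM cabs_real ger0_norm ?invr_ge0 ?(ltW gm0)// /c -!mulrA.
  rewrite ler_wpM2l ?invr_ge0 ?(ltW gm0)//.
  have -> : 2 * (B * (N * expR (- (4^-1 * dotv x x)))) = 2 * Lint (fun y => decay x * ind y).
    by rewrite (LintZ _ indic_Lintegrable) /decay -/N; ring.
  exact: (cabs_cint_le (mF1 x) (LintegrableZ (decay x) indic_Lintegrable) (F_le x)).
apply: L2_of_integrable => //.
have h : (0 : R) < 4^-1 by rewrite invr_gt0.
apply: (Lintegrable_le _ (Lintegrable_polyfun_gauss h (@polyfun_cst R n (c ^+ 2)))).
  by apply: measurable_funX; exact: measurable_cabs.
move=> x; rewrite ger0_norm ?exprn_ge0 ?cabs_ge0//.
apply: (@le_trans _ _ ((c * expR (- (4^-1 * dotv x x))) ^+ 2)).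
  have ce : 0 <= c * expR (- (4^-1 * dotv x x)) by rewrite mulr_ge0// expR_ge0.
  by rewrite ler_sqr ?nnegrE ?cabs_ge0.
rewrite exprMn ler_wpM2l ?exprn_ge0// expr2 ler_piMl ?expR_ge0//.
by rewrite -expR0 ler_expR oppr_le0 mulr_ge0 ?dotv_ge0// invr_ge0.
Qed.

(** The convolution theorem: Fubini, then translation by [y] in the inner integral. *)
Lemma fourier_gauss_conv xi : fourier v xi = gaussC xi * fourier u xi.
Proof.
have gm0' : gm != 0 by rewrite gt_eqF.
have mE : cmeas (fun x : Leb R n => expi (- dotv (x : 'rV[R]_n) xi)).
  apply: cmeas_expi; apply: measurable_funN.
  by apply: measurable_dotv; [exact: vmeas_id|exact: vmeas_cst].
have iF x : cintegrable (F x).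
  apply: (cintegrable_le (mF1 x) (LintegrableZ (decay x) indic_Lintegrable)).
  exact: F_le.
pose H x y := expi (- dotv x xi) * F x y.
transitivity ((gm^-1)%:C * cint (fun x => cint (H x))).
  rewrite -cintZ; last first.
    have := cintegrable_mull cintF mE; move=> /(_ _)[|? ?].
      by move=> x; rewrite cabs_expi.
    have -> : (fun x => cint (H x)) = (fun x => cint (F x) * expi (- dotv x xi)).
      by apply/funext => x; rewrite /H cintZ// mulrC.
    by split.
  congr cint; apply/funext => x; rewrite /v /H cintZ// -mulrA.
  by congr (_ * _); rewrite mulrC.
have mH : cmeas (fun z : Leb R n * Leb R n => H z.1 z.2).
  exact: (cmeasM (cmeas_comp measurable_fst mE) mF).
have H_le x y : cabs (H x y) <= decay x * ind y by rewrite cabsM cabs_expi mul1r.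
rewrite (cint_fubini mH decay_ge0 ind_ge0 decay_int indic_Lintegrable H_le).
have iu : cintegrable (fun y => u y * expi (- dotv y xi)).
  by apply: (cintegrable_mull indic_cintegrable mE) => y; rewrite cabs_expi.
have HE y : cint (fun x => H x y) = (gm * gauss xi)%:C * (u y * expi (- dotv y xi)).
  pose f x := (u y * expi (- dotv y xi)) * ((gauss (1 *: x))%:C * expi (dotv x (- xi))).
  have if1 : cintegrable (fun x => (gauss (1 *: x))%:C * expi (dotv x (- xi))).
    exact: cintegrable_gauss_expi.
  transitivity (cint (fun x => f (x + - y))).
    congr cint; apply/funext => x; rewrite /H /f /F scale1r.
    have -> : expi (- dotv x xi) = expi (- dotv y xi) * expi (dotv (x - y) (- xi)).
      rewrite -expiD; congr expi; rewrite [dotv _ (- xi)]dotvC dotvNl dotvDr.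
      by rewrite [dotv xi (- y)]dotvC dotvNl !(dotvC xi); ring.
    by ring.
  rewrite cint_shift; last exact: cintegrableZ.
  rewrite /f cintZ// cint_gauss_expi// expr1n invr1 mul1r scale1r gauss_neg.
  by rewrite mulrC.
have -> : (fun y => cint (fun x => H x y)) =
   (fun y => (gm * gauss xi)%:C * (u y * expi (- dotv y xi))) by apply/funext.
rewrite cintZ// mulrA -realCM mulrA mulVf// mul1r.
by [].
Qed.

Lemma fourierL2_indic : fourierL2 u (fourier u).
Proof.
split; [exact: indic_L2|split; first exact: indic_fourier_L2].
move=> phi sphi; apply: multiplication_formula; first exact: indic_cintegrable.
exact: schwartz_cintegrable.
Qed.

Lemma fourierL2_gauss_conv : fourierL2 v (fun xi => gaussC xi * fourier u xi).
Proof.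
have -> : (fun xi => gaussC xi * fourier u xi) = fourier v.
  by apply/funext => xi; rewrite fourier_gauss_conv.
split; [exact: gauss_conv_L2|split].
  have [mfu ifu] := indic_fourier_L2.
  have -> : fourier v = (fun xi => gaussC xi * fourier u xi).
    by apply/funext => xi; rewrite fourier_gauss_conv.
  have mgu : cmeas (fun xi : Leb R n => gaussC xi * fourier u xi).
    by apply: (cmeasM _ mfu); apply: cmeas_real; apply: measurable_gauss; exact: vmeas_id.
  apply: L2_of_integrable => //.
  have ig : Lintegrable (fun x => gauss (1 *: x + 0)) by exact: Lintegrable_gauss.
  apply: (Lintegrable_le _ (LintegrableZ ((2 * N) ^+ 2) ig)).
    by apply: measurable_funX; exact: measurable_cabs.
  move=> xi; rewrite ger0_norm ?exprn_ge0 ?cabs_ge0// cabsM cabs_real.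
  rewrite ger0_norm ?expR_ge0// exprMn mulrC scale1r addr0.
  apply: ler_pM; rewrite ?exprn_ge0 ?cabs_ge0 ?expR_ge0//.
    rewrite lerXn2r ?nnegrE ?cabs_ge0 ?mulr_ge0 ?Lint_indic_ge0//.
    by rewrite fourierE cabs_indic_fourier_le.
  rewrite expr2 ler_piMl ?expR_ge0// -expR0 ler_expR oppr_le0.
  by rewrite mulr_ge0 ?dotv_ge0// invr_ge0.
move=> phi sphi; apply: multiplication_formula; first exact: gauss_conv_cintegrable.
exact: schwartz_cintegrable.
Qed.

(** Kernel and indicator are nonnegative, so nothing cancels: the kernel is at least [expR (- c)]
    throughout [S]. *)
Lemma gauss_conv_ge x (c : R) : (forall y, S y -> dotv (x - y) (x - y) <= 2 * c) ->
  gm^-1 * (expR (- c) * fine (lebesgue R n S)) <= cabs (v x).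
Proof.
move=> xc; apply: le_trans (normr_cre_le _); apply: le_trans (ler_norm _).
rewrite /v.
have -> : cint (F x) = (Lint (fun y => gauss (x - y) * ind y))%:C.
  by rewrite -cint_real; congr cint; apply/funext => y; rewrite realCM.
rewrite -realCM /= ler_wpM2l ?invr_ge0 ?(ltW gm0)//.
have -> : fine (lebesgue R n S) = Lint ind.
  by rewrite -(Rintegral_indic (lebesgue R n) mS).
rewrite -LintZ; last exact: indic_Lintegrable.
apply: le_Rintegral => //.
- exact: (LintegrableZ _ indic_Lintegrable).
- apply: (Lintegrable_le _ (LintegrableZ (decay x) indic_Lintegrable)).
    by have [+ _] := mF1 x; congr measurable_fun; apply/funext => y; rewrite /F /u -realCM.
  by move=> y; have := F_le x y; rewrite /F /u -realCM cabs_real.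
- move=> y _; rewrite /ind indicE; have [yS|_] := boolP (y \in S); last by rewrite !mulr0.
  rewrite !mulr1 ler_expR lerN2 -(ler_pM2l (ltr0n R 2)) mulrA mulfV// mul1r.
  by apply: xc; exact/set_mem.
Qed.

End indicator_fourier.

(** * Failure on L^2 *)

Section failure_of_the_L2_bound.
Context {R : realType} {n : nat}.
Local Open Scope complex_scope.
Implicit Types (x y z : 'rV[R]_n).

Lemma dotv_le (r : R) z : (forall i, `|z 0 i| <= r) -> dotv z z <= n%:R * r ^+ 2.
Proof.
move=> zr; rewrite -[n in n%:R]card_ord -sum1_card natr_sum mulr_suml.
apply: ler_sum => i _; rewrite mul1r -expr2 -(real_normK (num_real (z 0 i))).
by rewrite lerXn2r ?nnegrE// (le_trans _ (zr i)).
Qed.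

(** On the unit cube the Gaussian is at least [expR (- n / 2)]. *)
Lemma gauss_mass_gt0 : (0 < lebesgue R n (cube 0 1))%E -> 0 < gauss_mass (R := R) (n := n).
Proof.
move=> c0.
have mc : measurable (cube 0 1 : set (Leb R n)) by exact: measurable_box.
have coo : (lebesgue R n (cube 0 1) < +oo)%E.
  by apply: le_lt_trans (lebesgue_cube_le _ _) _ => //; rewrite ltry.
have iI := LintegrableZ (expR (- (2^-1 * n%:R))) (integrable_indic_real mc coo).
have iG : Lintegrable (@gauss R n).
  have := Lintegrable_gauss (0 : 'rV[R]_n) ltr01.
  by congr Lintegrable; apply/funext => y; rewrite scale1r addr0.
apply: (@lt_le_trans _ _ (expR (- (2^-1 * n%:R)) * fine (lebesgue R n (cube 0 1)))).
  by rewrite mulr_gt0 ?expR_gt0// fine_gt0// c0 coo.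
rewrite -(Rintegral_indic _ mc) -[leLHS]LintZ; last exact: integrable_indic_real.
apply: (le_Rintegral _ iI iG) => // y _; rewrite indicE.
have [yc|_] := boolP (y \in _); last by rewrite mulr0 expR_ge0.
rewrite mulr1 ler_expR lerN2 ler_pM2l ?invr_gt0//.
rewrite -[leRHS]mulr1 -[X in _ * X](expr1n R 2); apply: dotv_le => i.
have := set_mem yc i; rewrite !mxE add0r => /andP[y0 y1].
by rewrite ger0_norm// ltW.
Qed.

Lemma not_multiplier0_gaussC (hn : (0 < n)%N) (G : set 'rV[R]_n) (b : nat -> R) :
  (forall x, G x -> forall i : 'I_n, 0 <= x 0 i <= 1) ->
  measurable (G : set (Leb R n)) -> (0 < lebesgue R n G)%E ->
  (forall m : nat, (0 < m)%N -> 0 < b m < 1) -> b @ \oo --> (0 : R) ->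
  (0 < lebesgue R n (cube 0 1))%E ->
  ~ multiplier0 (wGb hn G b) gaussC.
Proof.
move=> G01 mG G0 b01 b0 cube0 [_ [C HC]].
set w := wGb hn G b in HC.
pose i0 := Ordinal hn.
pose g := gauss_mass (R := R) (n := n).
have g0 : 0 < g by exact: gauss_mass_gt0.
have Goo : (lebesgue R n G < +oo)%E.
  apply: (@le_lt_trans _ _ (lebesgue R n (cube 0 2))).
    apply: lebesgue_le => x /G01 Gx i; have /andP[x0 x1] := Gx i.
    by rewrite !mxE add0r x0/= (le_lt_trans x1)// ltr1n.
  by apply: le_lt_trans (lebesgue_cube_le _ _) _ => //; rewrite ltry.
have w_ge0 y : 0 <= w y by have /andP[] := wGb_bound hn G01 b01 y.
(* Points of [G_m] and of the test cube beside it differ by at most 2 in each coordinate, so their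
   squared distance is at most [4 n = 2 c]. *)
pose c : R := 2 * n%:R.
pose delta := g^-1 * (expR (- c) * fine (lebesgue R n G)).
have delta0 : 0 < delta.
  by rewrite mulr_gt0 ?invr_gt0// mulr_gt0 ?expR_gt0// fine_gt0// G0 Goo.
have key m : (0 < m)%N -> delta <= `|C| * b m.
  move=> m0; pose S := Gm G m.
  have SE : S = affine 1 (- shift_vec m) @^-1` G.
    by apply/seteqP; split => y; rewrite /S /Gm /affine /= scale1r.
  have mS : measurable (S : set (Leb R n)).
    rewrite SE -[X in measurable X]setTI.
    exact: (measurable_affine (- shift_vec m) ltr01).
  have SG : lebesgue R n S = lebesgue R n G.
    by rewrite SE lebesgue_affine// expr1n invr1 mul1e.
  have Soo : (lebesgue R n S < +oo)%E by rewrite SG.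
  have SD y : S y -> dotv y y <= n%:R * ((2 * m)%:R + 1) ^+ 2.
    move=> Sy; apply: dotv_le => i.
    have [->|ii0] := eqVneq i i0.
      have /andP[y0 y1] := Gm_coord0 hn G01 Sy.
      by rewrite ger0_norm// (le_trans _ y0)// ler0n.
    have /andP[y0 y1] := Gm_coord G01 Sy ii0.
    by rewrite ger0_norm// (le_trans y1)// lerDr ler0n.
  have Hu := fourierL2_indic mS Soo g0.
  have Hv := fourierL2_gauss_conv mS Soo SD g0.
  pose u y : R[i] := (\1_S y : R)%:C.
  have wu : (wnorm w u <= (b m)%:E)%E.
    have /andP[bm0 _] := b01 m m0.
    apply: wnorm_le => y; rewrite cabs_real indicE.
    have [/set_mem yS|_] := boolP (y \in S); last by rewrite normr0 mul0r ltW.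
    by rewrite normr1 mul1r /w (wGb_Gm hn b G01 m0 yS).
  have wu0 : (0 <= wnorm w u)%E.
    by apply: (wnorm_ge cube0) => y _; rewrite mulr_ge0// cabs_ge0.
  have iu : in_Linfty_w w u.
    split; first exact: (cintegrable_cmeas (indic_cintegrable mS Soo)).
    by rewrite (le_lt_trans wu)// ltry.
  have := HC _ _ _ Hu.1 iu Hu Hv.
  set v := (X in wnorm w X) => wv.
  (* The cube of side 1/2 at [p] has first coordinates from [2m + 5/4] to [2m + 7/4], strictly
     inside the gap after [G_m], where the weight is 1. *)
  pose p : 'rV[R]_n := \row_i (if i == i0 then (2 * m)%:R + 1 + 4^-1 else 0).
  have wv_ge : (delta%:E <= wnorm w v)%E.
    have pc0 : (0 < lebesgue R n (cube p 2^-1))%E.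
      by apply: lebesgue_cube_gt0 => //; rewrite invr_gt0.
    apply: (wnorm_ge pc0) => x px.
    have := px i0; rewrite !mxE eqxx => /andP[x1 x2].
    rewrite /w (wGb_between b G01 (m := m)); last by apply/andP; split; lra.
    rewrite mulr1 /delta -SG.
    apply: (gauss_conv_ge mS Soo SD g0) => y Sy.
    rewrite /c mulrA -natrM mulrC -[(2 * 2)%N]/(2 ^ 2)%N natrX; apply: dotv_le => i.
    rewrite !mxE; have [->|ii0] := eqVneq i i0.
      have /andP[y0 y1] := Gm_coord0 hn G01 Sy.
      by rewrite ler_norml; apply/andP; split; lra.
    have /andP[y0 y1] := Gm_coord G01 Sy ii0.
    have := px i; rewrite !mxE (negbTE ii0) => /andP[? ?].
    by rewrite ler_norml; apply/andP; split; lra.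
  have := le_trans wv_ge wv.
  (* Since [C] may be negative, [|C|] is needed before [wnorm w u] can be replaced by its bound
     [b m]. *)
  have CC : (C%:E * wnorm w u <= `|C|%:E * wnorm w u)%E.
    by apply: lee_wpmul2r => //; rewrite lee_fin ler_norm.
  move=> /le_trans /(_ CC) h; rewrite -lee_fin; apply: (le_trans h).
  by rewrite EFinM; apply: lee_wpmul2l => //; rewrite lee_fin.
(* The added 1 covers [C = 0]; the index [N.+1] below is positive, as [key] demands. *)
have e0 : 0 < delta / (`|C| + 1) by rewrite divr_gt0// ltr_wpDl.
have /cvgr0_norm_lt/(_ _ e0)[N _ HN] := b0.
have h1 := key N.+1 isT; have /andP[bN0 _] := b01 N.+1 isT.
have := HN N.+1 (leqnSn N); rewrite /= (ger0_norm (ltW bN0)).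
rewrite ltr_pdivlMr ?ltr_wpDl// => h2.
move: h2; rewrite ltNge => /negP; apply; apply: (le_trans h1).
by rewrite mulrDr mulr1 mulrC lerDl ltW.
Qed.

End failure_of_the_L2_bound.

Unset Implicit Arguments.

Theorem theorem6p2 (R : realType) (n : nat) (hn : (0 < n)%N)
    (G : set 'rV[R]_n) (b : nat -> R) :
  (forall x : 'rV[R]_n, G x -> forall i : 'I_n, 0 <= x 0 i <= 1) ->
  compact G ->
  interior G = set0 ->
  (0 < lebesgue R n G)%E ->
  (forall m : nat, (0 < m)%N -> 0 < b m < 1) ->
  b @ \oo --> 0 ->
  exists a : 'rV[R]_n -> R[i],
    schwartz a /\
    multiplier_S (wGb hn G b) a /\
    ~ multiplier0 (wGb hn G b) a.
Proof.
move=> G01 cG iG G0 b01 b0.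
have closedG : closed G by apply: compact_closed => //; exact: norm_hausdorff.
have mG : measurable (G : set (Leb R n)).
  rewrite -[G]setCK; apply: measurableC; apply: measurable_open.
  exact: closed_openC.
(* If the unit cube were null, so would be its dilate [cube 0 2], which contains [G]. Side 2 is
   taken because cubes are half-open and [G] may touch the faces at 1. *)
have cube0 : (0 < lebesgue R n (cube 0 1))%E.
  rewrite ltNge; apply/negP => c0; move: G0; rewrite ltNge => /negP; apply.
  apply: (@le_trans _ _ (lebesgue R n (cube 0 2))).
    apply: lebesgue_le => x /G01 Gx i; have /andP[x0 x1] := Gx i.
    by rewrite !mxE add0r x0/= (le_lt_trans x1)// ltr1n.
  by rewrite lebesgue_cube// mule_ge0_le0// lee_fin exprn_ge0.
exists gaussC; split; first exact: schwartz_gaussC.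
split; last exact: not_multiplier0_gaussC.
apply: (multiplier_S_gaussC cube0); first exact: dense_unit_wGb.
exact: wGb_bound.
Qed.
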